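(* Consider a wireless network with $k\ge 2$ nodes, where node $1$ is the source node and the (nonempty) destination set is $\mathcal R\subset\{2,\dots,k\}$, and where channel state information is not available at the transmitters. Then the minimum energy per bit ${E_b}_{\min}(\mathcal R)$, normalized by the noise level $N_0$, satisfies $$\frac{{E_b}_{\min}(\mathcal R)}{N_0}\;\ge\;\frac{\log_e 2}{G(\mathcal R)},$$ where $G(\mathcal R)$ is the effective network radius $$G(\mathcal R)=\frac{1}{|\mathcal R|}\Bigl(\max_{i\in\{1,\dots,k\}}\ \sum_{j\in\mathcal R\setminus\{i\}}\mathbb E[|h_{ij}|^2]\Bigr).$$
   Context: Channel model. There are $k$ nodes. At discrete time $t$ node $i$ transmits $x_{i,t}\in\mathbb C$ and node $j$ receives $y_{j,t}=\sum_{i=1}^k h_{ij,t}x_{i,t}+z_{j,t}$. The noises $z_{j,t}$ are circularly symmetric complex Gaussian $\mathcal{CN}(0,N_0)$, $N_0>0$, independent over receivers $j$ and times $t$. The fading coefficients $h_{ij,t}$ ($i\ne j$) are circularly symmetric complex random variables, i.i.d. over time $t$; $h_{ij,t}$ and $h_{lm,t}$ are independent for $(i,j)\ne(l,m)$; and $h_{ii,t}=0$. Message, noise and fading are mutually independent. $\mathbb E[|h_{ij}|^2]$ (time index dropped) is the finite channel gain between $i$ and $j$. No channel state information at transmitters means: $x_{i,t}$ is independent of $(h_{i1,t},\dots,h_{ik,t})$ for all $i,t$. Codes. A code of block length $n$ with message set $\{1,\dots,M\}$ (message $m$ uniformly distributed) consists of: a source codeword $x_1^{(n)}(m)\in\mathbb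 C^n$ determined by the message; for each node $i\in\{2,\dots,k\}$, causal relay functions $x_{i,t}=x_{i,t}(y_{i,1},\dots,y_{i,t-1})$; and, for each $i\in\mathcal R$, a decoding function $\hat m_i=\hat m_i(y_{i,1},\dots,y_{i,n})$. The error probability is $P_e=\frac1M\sum_{m}P[\exists i\in\mathcal R:\hat m_i\ne m\mid m\text{ is the message}]$. The expected total energy of the code is $\mathbb E[\sum_{i=1}^k\sum_{t=1}^n|x_{i,t}|^2]$ (expectation over message, noise, fading). An $(n,M,E_{\rm total},\epsilon)$ code has block length $n$, $M$ messages, expected total energy at most $E_{\rm total}$, and error probability at most $\epsilon$. Minimum energy per bit. For $0\le\epsilon<1$, $E_b\in\mathbb R_+$ is $\epsilon$-achievable if for every $\delta>0$ there is $E_0\in\mathbb R_+$ such that for every $E_{\rm total}\ge E_0$ there is an $(n,M,E_{\rm total},\epsilon)$ code (for some $n,M$) with $E_{\rm total}/\log_2 M<E_b+\delta$. $E_b$ is achievable if it is $\epsilon$-achievable for all $0<\epsilon<1$. ${E_b}_{\min}(\mathcal R)$ is the infimum of the achievable values ($+\infty$ if there are none). The right-hand side of the claim is read as $+\infty$ if $G(\mathcal R)=0$. *)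

(* Defs.v *)
From HB Require Import structures.
From mathcomp Require Import all_boot all_order all_algebra.
From mathcomp Require Import all_classical all_reals all_analysis.
From mathcomp Require Import complex.

Set Implicit Arguments.
Unset Strict Implicit.
Unset Printing Implicit Defensive.

Import Order.TTheory GRing.Theory Num.Theory.
Import numFieldNormedType.Exports.

Local Open Scope classical_set_scope.
Local Open Scope ring_scope.

(* Borel sigma-algebra on the complex numbers, generated by Re and Im. *)
Section complex_measurable.
Variable R : realType.

HB.instance Definition _ := isPointed.Build R[i] 0.

Let measC : set (set R[i]) := g_sigma_preimageU (@complex.Re R) (@complex.Im R).

Let measC0 : measC set0. Proof. exact: sigma_algebra0. Qed.

Let measCC A : measC A -> measC (~` A). Proof. exact: sigma_algebraC. Qed.

Let measC_bigcup (F : (set R[i])^nat) :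
  (forall i, measC (F i)) -> measC (\bigcup_i F i).
Proof. exact: sigma_algebra_bigcup. Qed.

HB.instance Definition _ := @isMeasurable.Build default_measure_display
  R[i] measC measC0 measCC measC_bigcup.

End complex_measurable.

(* |c|^2 as a real number; the norm of R[i] takes its values in R[i]. *)
Definition sqmod (R : realType) (c : R[i]) : R :=
  complex.Re c ^+ 2 + complex.Im c ^+ 2.

Section probability_notions.
Context d (T : measurableType d) (R : realType) (P : probability T R).

Definition generated_sigma d' (T' : measurableType d') (I : Type)
    (X : I -> T -> T') : set (set T) :=
  <<s \bigcup_i preimage_set_system setT (X i) measurable >>.

Definition independent2 (F G : set (set T)) : Prop :=
  forall A B, F A -> G B -> P (A `&` B) = (P A * P B)%E.

Definition mutually_independent (I : eqType) (F : I -> set (set T)) : Prop :=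
  forall (s : seq I) (A : I -> set T), uniq s ->
    (forall i, i \in s -> F i (A i)) ->
    P (\big[setI/setT]_(i <- s) A i) = (\prod_(i <- s) P (A i))%E.

Definition cond_prob (A B : set T) : R := fine (P (A `&` B)) / fine (P B).

Definition same_law d' (T' : measurableType d') (X Y : T -> T') : Prop :=
  forall A, measurable A -> P (X @^-1` A) = P (Y @^-1` A).

Definition circularly_symmetric (X : T -> R[i]) : Prop :=
  forall u : R[i], `|u| = 1 -> same_law X (fun w => u * X w).

(* CN(0, v): real and imaginary parts independent N(0, v / 2); the second
   parameter of [normal_prob] is the standard deviation. *)
Definition complex_normal (v : R) (X : T -> R[i]) : Prop :=
  forall A B : set R, measurable A -> measurable B ->
    P [set w | A (complex.Re (X w)) /\ B (complex.Im (X w))] =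
    (normal_prob 0 (Num.sqrt (v / 2)) A *
     normal_prob 0 (Num.sqrt (v / 2)) B)%E.

End probability_notions.

Section network.
Context d (Omega : measurableType d) (R : realType) (P : probability Omega R).
Variables (k : nat) (N0 : R).
(* [h i j t] is the fading from node i to node j and [z j t] the noise at
   node j. Nodes are numbered from 0, so that node 0 is the source; times are
   numbered from 0 as well. *)
Variables (h : 'I_k -> 'I_k -> nat -> Omega -> R[i])
          (z : 'I_k -> nat -> Omega -> R[i]).

Definition gain (i j : 'I_k) : \bar R := ('E_P[fun w => sqmod (h i j 0%N w)])%E.

(* "I.i.d. over time" is independence over t of the whole matrices
   (h i j t)_(i, j), together with equality of the marginal laws. *)
Record fading_network : Prop := FadingNetwork {
  noise_level_gt0 : 0 < N0;
  noise_measurable : forall j t, measurable_fun setT (z j t);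
  noise_normal : forall j t, complex_normal P N0 (z j t);
  noise_independent : mutually_independent P
    (fun jt : 'I_k * nat => preimage_set_system setT (z jt.1 jt.2) measurable);
  fading_measurable : forall i j t, measurable_fun setT (h i j t);
  fading_diag : forall i t w, h i i t w = 0;
  fading_circular : forall i j t, i != j -> circularly_symmetric P (h i j t);
  fading_stationary : forall i j s t, same_law P (h i j s) (h i j t);
  fading_time_independent : mutually_independent P
    (fun t : nat => generated_sigma (fun ij : 'I_k * 'I_k => h ij.1 ij.2 t));
  fading_link_independent : forall i j l m t, (i, j) != (l, m) ->
    independent2 P (preimage_set_system setT (h i j t) measurable)
                   (preimage_set_system setT (h l m t) measurable);
  fading_gain_finite : forall i j, (gain i j < +oo)%E;
  noise_fading_independent : independent2 P
    (generated_sigma (fun jt : 'I_k * nat => z jt.1 jt.2))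
    (generated_sigma (fun ijt : 'I_k * 'I_k * nat =>
       h ijt.1.1 ijt.1.2 ijt.2))
}.

(* The messages are 0, ..., M - 1. Node i, having received its first t
   outputs, transmits [relay i t] of them; [relay] is not used at the source,
   and only the decoders of the destination nodes matter. *)
Record network_code (n M : nat) := NetworkCode {
  codeword : nat -> n.-tuple R[i];
  relay : forall (i : 'I_k) (t : nat), t.-tuple R[i] -> R[i];
  relay_measurable : forall i t, measurable_fun setT (@relay i t);
  decoder : 'I_k -> n.-tuple R[i] -> nat;
  decoder_measurable : forall i, measurable_fun setT (decoder i);
  decoder_lt : forall i y, (decoder i y < M)%N
}.

(* The uniform law on {0, ..., M - 1}, for M > 0. *)
Definition message_law (M : nat) : probability nat R :=
  mnormalize (msum (fun m : nat => \d_m) M) \d_0%N.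

(* Joint law of the message and of the channel: the message is uniform and
   independent of (h, z). *)
Definition joint_law (M : nat) : probability (nat * Omega)%type R :=
  (message_law M \x P)%E.

Section run.
Variables (n M : nat) (c : network_code n M).

Definition transmit (i : 'I_k) (t : nat) (m : nat) (past : t.-tuple R[i]) :
    R[i] :=
  if i == 0%N :> nat then nth 0 (codeword c m) t else relay c i past.

Fixpoint received (t : nat) (w : nat * Omega) : 'I_k -> t.-tuple R[i] :=
  match t with
  | 0%N => fun=> [tuple]
  | s.+1 => fun j => [tuple of rcons (received s w j)
      (\sum_(i < k) h i j s w.2 * transmit i w.1 (received s w i)
       + z j s w.2)]
  end.

Definition sent (i : 'I_k) (t : nat) (w : nat * Omega) : R[i] :=
  transmit i w.1 (received t w i).

Definition no_csit : Prop := forall (i : 'I_k) (t : nat), (t < n)%N ->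
  independent2 (joint_law M)
    (preimage_set_system setT (sent i t) measurable)
    (generated_sigma (fun (j : 'I_k) (w : nat * Omega) => h i j t w.2)).

Definition total_energy : \bar R :=
  ('E_(joint_law M)[fun w => (\sum_(i < k) \sum_(t < n) sqmod (sent i t w))%R])%E.

Definition error_event (Dest : {set 'I_k}) : set (nat * Omega) :=
  [set w | exists2 i, i \in Dest & decoder c i (received n w i) <> w.1].

Definition error_probability (Dest : {set 'I_k}) : R :=
  (\sum_(m < M) cond_prob (joint_law M)
     (error_event Dest) [set w | w.1 = m :> nat]) / M%:R.

End run.

Definition is_code (Dest : {set 'I_k}) (n M : nat) (Etotal eps : R)
    (c : network_code n M) : Prop :=
  [/\ no_csit c, (total_energy c <= Etotal%:E)%E
    & error_probability c Dest <= eps].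

Definition log2 (x : R) : R := ln x / ln 2.

(* M = 1 has infinite energy per bit (log2 1 = 0), but [x / 0 = 0] here; hence
   the requirement 1 < M. *)
Definition eps_achievable (Dest : {set 'I_k}) (eps Eb : R) : Prop :=
  0 <= Eb /\
  forall delta : R, 0 < delta -> exists2 E0 : R, 0 <= E0 &
    forall Etotal : R, E0 <= Etotal ->
      exists n M (c : network_code n M),
        [/\ is_code Dest Etotal eps c, (1 < M)%N
          & Etotal / log2 M%:R < Eb + delta].

Definition achievable (Dest : {set 'I_k}) (Eb : R) : Prop :=
  forall eps, 0 < eps < 1 -> eps_achievable Dest eps Eb.

Definition Eb_min (Dest : {set 'I_k}) : \bar R :=
  ereal_inf [set Eb%:E | Eb in achievable Dest].

Definition network_radius (Dest : {set 'I_k}) : \bar R :=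
  ((\big[maxe/0]_(i < k) \sum_(j in Dest :\ i) gain i j) / #|Dest|%:R%:E)%E.

End network.

(* Main.v *)
From HB Require Import structures.
Require Import Defs.
From mathcomp Require Import all_boot all_order all_algebra.
From mathcomp Require Import all_classical all_reals all_analysis.
From mathcomp Require Import complex measurable_realfun ring lra.
Import Order.TTheory GRing.Theory Num.Theory.
Import numFieldNormedType.Exports.
Set Implicit Arguments.
Unset Strict Implicit.
Unset Printing Implicit Defensive.
Local Open Scope classical_set_scope.
Local Open Scope ring_scope.

(* Fix a destination j and a message m, and let s_t be the noiseless signal
   received by j at time t, so that y_t = s_t + z_t. Girsanov's change of
   measure with density exp (- L), where L is the sum over t of
   (|s_t + z_t|^2 - |z_t|^2) / N0, turns y into pure noise, which is
   independent of the message and is thus decoded correctly with probability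
   1 / M only. Since E L is the sum of the E |s_t|^2 / N0, convexity of exp
   bounds (1 - eps) ln M - 1 by the average over m of E L. The inputs at time t
   are independent of the fading at time t, whose coefficients are uncorrelated
   and centered, so that E |s_t|^2 is the sum over i of
   E |h_ij|^2 E |x_(i,t)|^2. Averaging over the destinations j bounds the right
   hand side by the network radius times the total energy over N0. *)

(** * Integrals against the normal law *)

(** Relays couple every output to the noise of the whole network, so a converse through mutual
    information would have to handle conditional entropies of variables without explicit laws. The
    exponential weight needs only one Gaussian translation per time step, and the tangent inequality
    1 + u <= exp u, at u = ln M - L where the message is decoded and at u = - L elsewhere, replaces
    the entropy inequalities. The loss of 1 is harmless: at a bounded energy per bit, a large energy
    forces ln M to be large. Two different pasts occur. For the noise at time t one freezes the
    earlier noise and the fading at all times, since the signal at time t already involves the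
    fading at time t. For the fading at time t one freezes the earlier fading and all of the noise.
    Neither past is encoded as a random vector: each is a coarser sigma-algebra on the same sample
    space, for which the inputs are measurable by causality. E L is meaningful only for signals of
    finite power, which the finite total energy and the finite gains provide. *)

Section integral_density.
Local Open Scope ereal_scope.
Context d (T : measurableType d) (R : realType).
Variables (mu nu : {measure set T -> \bar R}) (g : T -> R).
Hypothesis mg : measurable_fun setT g.
Hypothesis g_ge0 : forall x, (0 <= g x)%R.
Hypothesis nuE : forall A, measurable A -> nu A = \int[mu]_(x in A) (g x)%:E.

Import HBNNSimple.

(** By linearity over the values of [f], this reduces to [nuE] on level sets; monotone limits then
    give all nonnegative functions. *)
Lemma integral_density_nnsfun (f : {nnsfun T >-> R}) :
  \int[nu]_x (f x)%:E = \int[mu]_x ((f x)%:E * (g x)%:E).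
Proof.
under eq_integral do rewrite fimfunE -fsumEFin//.
rewrite [LHS]ge0_integral_fsum//; last 2 first.
  - by move=> r; exact/measurable_EFinP/measurableT_comp.
  - by move=> n x _; rewrite EFinM nnfun_muleindic_ge0.
under [RHS]eq_integral.
  move=> x xD; rewrite fimfunE -fsumEFin// ge0_mule_fsuml; last first.
    by move=> r; rewrite EFinM nnfun_muleindic_ge0.
  over.
rewrite [RHS]ge0_integral_fsum//; last 2 first.
  - move=> r; apply: emeasurable_funM; last exact/measurable_EFinP.
    by apply/measurable_EFinP; do 2 apply/measurableT_comp => //.
  - move=> n x _; rewrite mule_ge0 ?lee_fin//.
    by have := nnfun_muleindic_ge0 f n x; rewrite -EFinM lee_fin.
apply: eq_fsbigr => r _.
rewrite integralZl_indic_nnsfun// integral_indic// setIT nuE//.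
(* The sum ranges over all reals [r]; a negative [r] has an empty level set and is set aside, so
   that only nonnegative constants cross the integral. *)
have r0 : (r < 0)%R -> f @^-1` [set r] = set0.
  by move=> r0; apply: preimage_nnfun0.
have [rlt0|rge0] := ltP r 0%R.
  rewrite r0// integral_set0 mule0 integral0_eq// => x _.
  by rewrite indic0 mulr0 mul0e.
rewrite integral_mkcond -ge0_integralZl//; last 2 first.

  - apply/(measurable_restrictT _ _).1 => //; exact/measurable_EFinP/measurable_funTS.
  - by move=> x _; apply: erestrict_ge0 => y _; rewrite lee_fin.
apply: eq_integral => x _; rewrite patchE indicE.
by case: ifPn => _; rewrite ?mulr1 ?mule0 ?mulr0 ?mul0e.
Qed.

Lemma ge0_integral_density (f : T -> \bar R) :
  measurable_fun setT f -> (forall x, 0 <= f x) ->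
  \int[nu]_x f x = \int[mu]_x (f x * (g x)%:E).
Proof.
move=> mf f0; pose f_ := nnsfun_approx measurableT mf.
transitivity (lim (\int[nu]_x (f_ n x)%:E @[n --> \oo])).
  rewrite -monotone_convergence//=.
  - by apply: eq_integral => ? _; apply/esym/cvg_lim => //=; exact: cvg_nnsfun_approx.
  - by move=> n; exact/measurable_EFinP.
  - by move=> n ? _; rewrite lee_fin.
  - by move=> ? _ ? ? mn; rewrite lee_fin; exact/lefP/nd_nnsfun_approx.
rewrite (_ : (fun n => _) = fun n => \int[mu]_x ((f_ n x)%:E * (g x)%:E)); last first.
  by apply/funext => n; exact: integral_density_nnsfun.
rewrite -monotone_convergence//=.
- apply: eq_integral => x _; apply/cvg_lim => //=.
  by apply: cvgeZr => //; exact: cvg_nnsfun_approx.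
- move=> n; apply: emeasurable_funM; exact/measurable_EFinP.
- by move=> n ? _; rewrite mule_ge0// lee_fin.
- move=> x _ a b ab; rewrite lee_wpmul2r ?lee_fin//.
  exact/lefP/nd_nnsfun_approx.
Qed.

End integral_density.

(** * Invariance of Lebesgue measure under translation and reflection *)

Section lebesgue_isometries.
Local Open Scope ereal_scope.
Variable R : realType.
Local Notation mu := (@lebesgue_measure R).

(** By uniqueness of Lebesgue measure, it suffices that the image measure gives half-open intervals
    their length. *)
Lemma lebesgue_measure_translation (a : R) (A : set R) : measurable A ->
  mu ((fun x => a + x)%R @^-1` A) = mu A.
Proof.
have ma : measurable_fun setT (fun x : R => a + x)%R by exact: measurable_funD.
move=> mA; apply/esym.
pose T := measurableTypeR R.
apply: (@lebesgue_measure_unique R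
  (pushforward mu ((fun x => a + x)%R : T -> T))) => //.
move=> _ [[u v] _ <-] /=; rewrite /pushforward.
rewrite [X in _ = mu X](_ : _ = `]u - a, v - a]%classic)%R.
  rewrite !lebesgue_measure_itv /= !lte_fin ltrD2r; case: ifPn => // _.
  by rewrite -!EFinD; congr EFin; ring.
by apply/seteqP; split => x /=; rewrite !in_itv/= ltrBlDl lerBrDl.
Qed.

(** Uniqueness again; reflection moves the closed end of the interval from right to left, which
    leaves the measure unchanged. *)
Lemma lebesgue_measure_opp (A : set R) : measurable A ->
  mu (-%R @^-1` A) = mu A.
Proof.
have mo : measurable_fun setT (-%R : R -> R) by exact: oppr_measurable.
move=> mA; apply/esym.
pose T := measurableTypeR R.
apply: (@lebesgue_measure_unique R (pushforward mu (-%R : T -> T))) => //.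
move=> _ [[u v] _ <-] /=; rewrite /pushforward.
rewrite [X in _ = mu X](_ : _ = `[- v, - u[%classic)%R.
  rewrite !lebesgue_measure_itv /= !lte_fin ltrN2; case: ifPn => // _.
  by rewrite -!EFinD; congr EFin; ring.
by apply/seteqP; split => x /=; rewrite !in_itv/= ltrNr lerNl andbC.
Qed.

Lemma ge0_integral_translation (a : R) (f : R -> \bar R) :
  measurable_fun setT f -> (forall x, 0 <= f x) ->
  \int[mu]_x f (a + x)%R = \int[mu]_x f x.
Proof.
move=> mf f0.
pose T := measurableTypeR R.
have ma : measurable_fun (setT : set T) ((fun x => a + x)%R : T -> T).
  exact: measurable_funD.
rewrite -[LHS](@ge0_integral_pushforward _ _ _ _ R _ ma mu setT f)//.
by apply: eq_measure_integral => A mA _; exact: lebesgue_measure_translation.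
Qed.

Lemma ge0_integral_opp (f : R -> \bar R) :
  measurable_fun setT f -> (forall x, 0 <= f x) ->
  \int[mu]_x f (- x)%R = \int[mu]_x f x.
Proof.
move=> mf f0.
pose T := measurableTypeR R.
have mo : measurable_fun (setT : set T) (-%R : T -> T).
  exact: oppr_measurable.
rewrite -[LHS](@ge0_integral_pushforward _ _ _ _ R _ mo mu setT f)//.
by apply: eq_measure_integral => A mA _; exact: lebesgue_measure_opp.
Qed.

End lebesgue_isometries.

Section normal_integrals.
Local Open Scope ereal_scope.
Variables (R : realType) (s : R).
Hypothesis s_gt0 : (0 < s)%R.
Local Notation mu := (@lebesgue_measure R).
Local Notation N := (normal_prob 0 s).

Lemma ge0_integral_normal (f : R -> \bar R) :
  measurable_fun setT f -> (forall x, 0 <= f x) ->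
  \int[N]_x f x = \int[mu]_x (f x * (normal_pdf 0 s x)%:E).
Proof.
move=> mf f0; apply: ge0_integral_density => //.
- exact: measurable_normal_pdf.
- exact: normal_pdf_ge0.
Qed.

(** The exponential is a likelihood ratio: the normalising constants cancel and the exponents add
    up. *)
Lemma normal_pdf_translation (a x : R) :
  (expR (- (((a + x) ^+ 2 - x ^+ 2) / (s ^+ 2 *+ 2))) * normal_pdf 0 s x =
   normal_pdf 0 s (a + x))%R.
Proof.
rewrite !normal_pdfE ?gt_eqF// mulrCA /normal_fun -expRD; congr (_ * expR _)%R.
rewrite -mulNr -mulrDl; congr (_ / _)%R; ring.
Qed.

Lemma measurable_translation_ratio (a : R) : measurable_fun setT
  (fun x : R => expR (- (((a + x) ^+ 2 - x ^+ 2) / (s ^+ 2 *+ 2))))%R.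
Proof.
have ma : measurable_fun setT (fun x : R => a + x)%R by exact: measurable_funD.
apply: measurableT_comp => //; apply: measurable_funN.
apply: measurable_funM => //; apply: measurable_funB; last exact: measurable_funX.
exact: (@measurable_funX _ _ R setT (fun x => a + x)%R).
Qed.

(** The one-dimensional Cameron-Martin formula: the weight turns the density at [x] into the density
    at [a + x], and Lebesgue measure absorbs the shift. *)
Lemma ge0_integral_normal_translation (a : R) (f : R -> \bar R) :
  measurable_fun setT f -> (forall x, 0 <= f x) ->
  \int[N]_x (f (a + x)%R *
    (expR (- (((a + x) ^+ 2 - x ^+ 2) / (s ^+ 2 *+ 2))))%:E) = \int[N]_x f x.
Proof.
move=> mf f0.
have ma : measurable_fun setT (fun x : R => a + x)%R by exact: measurable_funD.
rewrite !ge0_integral_normal//; last 2 first.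
- apply: emeasurable_funM; first exact: (measurableT_comp mf ma).
  by apply/measurable_EFinP; exact: measurable_translation_ratio.
- by move=> x; rewrite mule_ge0 // lee_fin expR_ge0.
pose g (x : R) := f x * (normal_pdf 0 s x)%:E.
rewrite -[RHS](ge0_integral_translation (f := g) a); last 2 first.
- apply: emeasurable_funM => //; apply/measurable_EFinP; exact: measurable_normal_pdf.
- by move=> x; rewrite /g mule_ge0// lee_fin normal_pdf_ge0.
apply: eq_integral => x _.
by rewrite -muleA -EFinM normal_pdf_translation.
Qed.

Lemma ge0_integral_normal_opp (f : R -> \bar R) :
  measurable_fun setT f -> (forall x, 0 <= f x) ->
  \int[N]_x f (- x)%R = \int[N]_x f x.
Proof.
move=> mf f0.
rewrite !ge0_integral_normal//; last first.
  by apply: (measurableT_comp mf); apply: measurable_funN.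
pose g (x : R) := f x * (normal_pdf 0 s x)%:E.
rewrite -[RHS](ge0_integral_opp (f := g)); last 2 first.
- apply: emeasurable_funM => //; apply/measurable_EFinP; exact: measurable_normal_pdf.
- by move=> x; rewrite /g mule_ge0// lee_fin normal_pdf_ge0.
apply: eq_integral => x _; congr (_ * _%:E).
by rewrite !normal_pdfE ?gt_eqF// /normal_fun !subr0 sqrrN.
Qed.

(** The square is dominated by 4 (exp x + exp (- x)), whose integral is finite because exponential
    moments are. *)
Lemma integral_normal_sqr_lty : \int[N]_x (x ^+ 2)%:E < +oo.
Proof.
(* The exponential moment at a comes from integrating 1 in the translation formula. *)
have expE (a : R) : \int[N]_x (expR (a * x))%:E < +oo.
  (* With this shift the term of the exponent that is linear in [x] is exactly [a * x]; the rest is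
     a constant. *)
  pose b := (- a * s ^+ 2)%R.
  have := @ge0_integral_normal_translation b (cst 1) (measurable_cst _)
    (fun=> lee01).
  rewrite integral_cst//= mul1e probability_setT.
  under eq_integral do rewrite mul1e.
  move=> E.
  have -> : \int[N]_x (expR (a * x))%:E =
      (expR (b ^+ 2 / (s ^+ 2 *+ 2)))%:E * 1.
    rewrite -[X in _ * X]E -ge0_integralZl//; last first.
      by apply/measurable_EFinP; exact: measurable_translation_ratio.
    apply: eq_integral => x _; rewrite -EFinM -expRD; congr (expR _)%:E.
    by rewrite /b; field; rewrite gt_eqF.
  by rewrite mule1 ltry.
(* Square the inequality x / 2 <= exp (x / 2). *)
have exp_sqr (x : R) : (0 <= x -> x ^+ 2 <= 4 * expR x)%R.
  move=> x0; have -> : expR x = (expR (x / 2) ^+ 2)%R.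
    by rewrite -expRM_natl mulrC divfK.
  rewrite -[X in (X * _)%R](_ : 2 ^+ 2 = 4)%R; last by ring.
  rewrite -exprMn lerXn2r// ?nnegrE ?mulr_ge0 ?expR_ge0//.
  have := expR_ge1Dx (x / 2); lra.
apply: (@le_lt_trans _ _
    (\int[N]_x (4%:E * ((expR (1 * x))%:E + (expR (-1 * x))%:E)))).
  apply: ge0_le_integral => //=.
  - by move=> x _; rewrite lee_fin sqr_ge0.
  - by apply/measurable_EFinP; exact: measurable_funX.
  - apply/measurable_EFinP; apply: measurable_funM => //.
    by apply: measurable_funD; apply: measurableT_comp => //; apply: measurable_funM.
  - move=> x _; rewrite -EFinD -EFinM lee_fin mul1r mulN1r mulrDr.
    have [x0|x0] := leP 0%R x.
      by rewrite (le_trans (exp_sqr _ x0))// lerDl mulr_ge0 ?expR_ge0.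
    rewrite -sqrrN (le_trans (exp_sqr (- x) _)%R) ?oppr_ge0 ?ltW//.
    by rewrite ltrDr mulr_gt0 ?expR_gt0.
have me (a : R) : measurable_fun setT (fun x : R => (expR (a * x))%:E).
  by apply/measurable_EFinP/measurableT_comp => //; exact: measurable_funM.
have me2 : measurable_fun setT
    (fun x : R => (expR (1 * x))%:E + (expR (-1 * x))%:E).
  exact: (emeasurable_funD (me 1%R) (me (-1)%R)).
rewrite ge0_integralZl//; last first.
  by move=> x _; rewrite adde_ge0// lee_fin expR_ge0.
rewrite ge0_integralD//; [|exact: (me 1%R)|exact: (me (-1)%R)].
by rewrite lte_mul_pinfty// lte_add_pinfty.
Qed.

End normal_integrals.

(** * Complex random variables and independence *)

Section complex_measurability.
Variable R : realType.

(** The sigma-algebra of [R[i]] is generated by the two coordinates, and taking preimages by [f]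
    commutes with generation. All complex measurability is thereby reduced to the real case. *)
Lemma measurable_funReIm d (T : measurableType d) (f : T -> R[i]) :
  measurable_fun setT f <->
  measurable_fun setT (fun x => complex.Re (f x)) /\
  measurable_fun setT (fun x => complex.Im (f x)).
Proof.
pose pre := g_sigma_preimageU (@complex.Re R \o f) (@complex.Im R \o f).
apply: (@iff_trans _ (pre `<=` measurable)).
- rewrite /pre g_sigma_preimageU_comp; split=> [mf A [C HC <-]|f12].
    exact: mf.
  by move=> _ A mA; apply: f12; exists A.
- split => [h12|[mf1 mf2]].
    split => _ A mA; apply: h12; apply: sub_sigma_algebra;
    by [left; exists A|right; exists A].
  apply: smallest_sub; first exact: sigma_algebra_measurable.
  by rewrite subUset; split=> [|] A [C mC <-]; [exact: mf1|exact: mf2].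
Qed.

Lemma measurable_Re : measurable_fun setT (@complex.Re R).
Proof. by have /measurable_funReIm[] := @measurable_id _ R[i] setT. Qed.

Lemma measurable_Im : measurable_fun setT (@complex.Im R).
Proof. by have /measurable_funReIm[] := @measurable_id _ R[i] setT. Qed.

Lemma measurable_complex_opp : measurable_fun setT (-%R : R[i] -> R[i]).
Proof.
apply/measurable_funReIm; split.
- under eq_fun do rewrite raddfN.
  exact: (measurable_funN measurable_Re).
- under eq_fun do rewrite raddfN.
  exact: (measurable_funN measurable_Im).
Qed.

Section operations.
Context d (T : measurableType d).
Implicit Types f g : T -> R[i].

Lemma measurable_complexD f g : measurable_fun setT f -> measurable_fun setT g ->
  measurable_fun setT (fun x => f x + g x).
Proof.
move=> /measurable_funReIm[fr fi] /measurable_funReIm[gr gi].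
apply/measurable_funReIm; split.
- under eq_fun do rewrite raddfD.
  exact: measurable_funD.
- under eq_fun do rewrite raddfD.
  exact: measurable_funD.
Qed.

Lemma measurable_complexM f g : measurable_fun setT f -> measurable_fun setT g ->
  measurable_fun setT (fun x => f x * g x).
Proof.
move=> /measurable_funReIm[fr fi] /measurable_funReIm[gr gi].
apply/measurable_funReIm; split.
- rewrite (_ : (fun x => _) = fun x => complex.Re (f x) * complex.Re (g x) -
    complex.Im (f x) * complex.Im (g x)); last first.
    by apply/funext => x; case: (f x) (g x) => a b [].
  by apply: measurable_funB; exact: measurable_funM.
- rewrite (_ : (fun x => _) = fun x => complex.Re (f x) * complex.Im (g x) +
    complex.Im (f x) * complex.Re (g x)); last first.
    by apply/funext => x; case: (f x) (g x) => a b [].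
  by apply: measurable_funD; exact: measurable_funM.
Qed.

Lemma measurable_complex_sum I (s : seq I) (f : I -> T -> R[i]) :
  (forall i, measurable_fun setT (f i)) ->
  measurable_fun setT (fun x => \sum_(i <- s) f i x).
Proof.
move=> mf; elim: s => [|i s ih].
  by under eq_fun do rewrite big_nil; exact: measurable_cst.
by under eq_fun do rewrite big_cons; exact: measurable_complexD.
Qed.

Lemma measurable_sqmod f : measurable_fun setT f ->
  measurable_fun setT (fun x => sqmod (f x)).
Proof.
by move=> /measurable_funReIm[fr fi]; apply: measurable_funD; exact: measurable_funX.
Qed.

End operations.

(** The inner product of the plane, that is the real part of a times the conjugate of b. It is the
    cross term of a squared modulus, so only this real part has to average to 0. *)
Definition dotc (a b : R[i]) : R :=
  complex.Re a * complex.Re b + complex.Im a * complex.Im b.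

Lemma measurable_dotc d (T : measurableType d) (f g : T -> R[i]) :
  measurable_fun setT f -> measurable_fun setT g ->
  measurable_fun setT (fun x => dotc (f x) (g x)).
Proof.
move=> /measurable_funReIm[fr fi] /measurable_funReIm[gr gi].
by apply: measurable_funD; exact: measurable_funM.
Qed.

Lemma dotcC a b : dotc a b = dotc b a.
Proof. by rewrite /dotc; ring. Qed.

Lemma dotcNr a b : dotc a (- b) = - dotc a b.
Proof. by case: a b => ? ? [? ?]; rewrite /dotc /=; ring. Qed.

Lemma dotcc (a : R[i]) : dotc a a = sqmod a.
Proof. by []. Qed.

Lemma dotc_suml I (s : seq I) (f : I -> R[i]) b :
  dotc (\sum_(i <- s) f i) b = \sum_(i <- s) dotc (f i) b.
Proof.
elim: s => [|i s ih]; first by rewrite !big_nil /dotc /=; ring.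
by rewrite !big_cons -ih /dotc !raddfD; ring.
Qed.

Lemma dotc_sumr I (s : seq I) (f : I -> R[i]) a :
  dotc a (\sum_(i <- s) f i) = \sum_(i <- s) dotc a (f i).
Proof. by rewrite dotcC dotc_suml; apply: eq_bigr => i _; exact: dotcC. Qed.

Lemma sqmodD (a b : R[i]) : sqmod (a + b) = sqmod a + 2 * dotc a b + sqmod b.
Proof. by rewrite /sqmod /dotc !raddfD; ring. Qed.

Lemma sqmodM (a b : R[i]) : sqmod (a * b) = sqmod a * sqmod b.
Proof. by case: a b => ? ? [? ?]; rewrite /sqmod /=; ring. Qed.

Lemma sqmod_ge0 (a : R[i]) : 0 <= sqmod a.
Proof. by rewrite addr_ge0// sqr_ge0. Qed.

Lemma sqmodN (a : R[i]) : sqmod (- a) = sqmod a.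
Proof. by rewrite /sqmod !raddfN; ring. Qed.

(** Both |a + b|^2 and |a - b|^2 are nonnegative. The bound is not sharp; it serves for
    integrability only. *)
Lemma normr_dotc_le (a b : R[i]) : `|dotc a b| <= sqmod a + sqmod b.
Proof.
have := sqmod_ge0 (a + b); have := sqmod_ge0 (a - b).
rewrite !sqmodD dotcNr sqmodN ler_norml.
have := sqmod_ge0 a; have := sqmod_ge0 b; lra.
Qed.

End complex_measurability.

(** * Independence of generated sigma-algebras *)

Section independence.
Local Open Scope ereal_scope.
Context d (T : measurableType d) (R : realType) (P : probability T R).
Implicit Types F G H : set (set T).

Lemma independent2C F G : independent2 P F G -> independent2 P G F.
Proof. by move=> FG A B GA FB; rewrite setIC (FG B A)// muleC. Qed.

Lemma independent2_sub F G F' G' : F' `<=` F -> G' `<=` G ->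
  independent2 P F G -> independent2 P F' G'.
Proof. by move=> FF GG FG A B /FF FA /GG GB; exact: FG. Qed.

(** For fixed [B], the finite measures P(A & B) and P(A) P(B) of [A] agree on the pi-system [F],
    hence on the sigma-algebra it generates. *)
Lemma independent2_sigma F G : setI_closed F -> F setT ->
  F `<=` measurable -> G `<=` measurable ->
  independent2 P F G -> independent2 P <<s F >> G.
Proof.
move=> FI FT mF mG FG A B sFA GB; have mB := mG _ GB.
have PBfin : P B \is a fin_num by exact: fin_num_measure.
have PB0 : (0 <= fine (P B))%R by rewrite fine_ge0.
rewrite -(fineK PBfin) muleC.
apply: (g_sigma_algebra_measure_unique F mF (fun=> setT) _ _
  (mrestr P mB) (mscale (NngNum PB0) P)) => //.
- by rewrite bigcup_const//; exists 0%N.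
- move=> C FC; change (P (C `&` B) = (fine (P B))%:E * P C).
  by rewrite FG// fineK// muleC.
- move=> _; change (P (setT `&` B) < +oo); rewrite setTI.
  by rewrite (le_lt_trans (probability_le1 P mB))// ltry.
Qed.

(** A pi-system generating the join of two families; unlike their union, it is stable under
    intersection. *)
Definition setI_system F G : set (set T) := [set A `&` B | A in F & B in G].

Lemma setI_system_setI_closed F G : setI_closed F -> setI_closed G ->
  setI_closed (setI_system F G).
Proof.
move=> FI GI _ _ [A FA [B GB <-]] [A' FA' [B' GB' <-]].
exists (A `&` A'); first exact: FI.
by exists (B `&` B'); [exact: GI|rewrite setIACA].
Qed.

Lemma setI_systemT F G : F setT -> G setT -> setI_system F G setT.
Proof. by move=> FT GT; exists setT => //; exists setT => //; rewrite setTI. Qed.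

Lemma sub_setI_systeml F G : G setT -> F `<=` setI_system F G.
Proof. by move=> GT A FA; exists A => //; exists setT => //; rewrite setIT. Qed.

Lemma sub_setI_systemr F G : F setT -> G `<=` setI_system F G.
Proof. by move=> FT A GA; exists setT => //; exists A => //; rewrite setTI. Qed.

Lemma setI_system_measurable F G : F `<=` measurable -> G `<=` measurable ->
  setI_system F G `<=` measurable.
Proof. by move=> mF mG _ [A /mF mA [B /mG mB <-]]; exact: measurableI. Qed.

(** All three probabilities factor: P(A & B & C) = P(A) P(B) P(C) and P(A & C) = P(A) P(C). Below,
    [F] is the earlier part of a process, [G] its present, and [H] the whole of the other process,
    which thus joins the past. *)
Lemma independent2_exchange F G H : setI_closed F -> F setT ->
  setI_closed H -> H setT -> G setT ->
  F `<=` measurable -> G `<=` measurable -> H `<=` measurable ->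
  independent2 P F G -> independent2 P (setI_system F G) H ->
  independent2 P <<s setI_system F H >> G.
Proof.
move=> FI FT HI HT GT mF mG mH FG FGH; apply: independent2_sigma => //.
- exact: setI_system_setI_closed.
- exact: setI_systemT.
- exact: setI_system_measurable.
move=> _ B [A FA [C HC <-]] GB.
have -> : A `&` C `&` B = A `&` B `&` C by rewrite setIAC.
rewrite FGH//; last by exists A => //; exists B.
rewrite (FG A B)// (FGH A C)//; last exact: sub_setI_systeml.
by rewrite muleAC.
Qed.

Section cylinders.
Variables (I : eqType) (F : I -> set (set T)).
Hypotheses (FI : forall i, setI_closed (F i)) (FT : forall i, F i setT).
Hypothesis mF : forall i, F i `<=` measurable.

(** A pi-system for the join of the [F i] with [i] in [s]; an index is left unconstrained by taking
    [setT] there. *)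
Definition cylinders (s : seq I) : set (set T) :=
  [set \big[setI/setT]_(i <- s) A i | A in
    [set A : I -> set T | forall i, F i (A i)]].

Lemma cylinders_setI_closed s : setI_closed (cylinders s).
Proof.
move=> _ _ [A FA <-] [B FB <-]; exists (fun i => A i `&` B i).
  by move=> i; exact: FI.
by rewrite big_split.
Qed.

Lemma cylindersT s : cylinders s setT.
Proof. by exists (fun=> setT) => //; rewrite big1. Qed.

Lemma cylinders_measurable s : cylinders s `<=` measurable.
Proof.
move=> _ [A FA <-]; elim/big_ind : _ => //; first exact: measurableI.
by move=> i _; exact/mF/FA.
Qed.

Lemma sub_cylinders s i : uniq s -> i \in s -> F i `<=` cylinders s.
Proof.
move=> us si A FA; exists (fun j => if j == i then A else setT).
  by move=> j; case: eqP => [->|].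
rewrite (bigD1_seq i)//= eqxx big1 ?setIT// => j /negbTE ->.
by [].
Qed.

Lemma cylinders_independent s i : mutually_independent P F -> uniq s ->
  i \notin s -> independent2 P (cylinders s) (F i).
Proof.
move=> PF us si _ B [A FA <-] FB.
(* Mutual independence along [i :: s] is used twice: with [B] at [i], and with [setT] at [i] to
   recover the product over [s] alone. *)
pose A' C j := if j == i then C else A j.
have A's C j : j \in s -> A' C j = A j.
  by rewrite /A'; case: eqP => // -> si'; rewrite si' in si.
have FA' C : F i C -> forall j, j \in i :: s -> F j (A' C j).
  by move=> FC j _; rewrite /A'; case: eqP => [->|].
have PE C : F i C ->
    P (C `&` \big[setI/setT]_(j <- s) A j) = P C * \prod_(j <- s) P (A j).
  move=> FC; have := PF (i :: s) (A' C); rewrite /= si us => /(_ isT (FA' C FC)).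
  rewrite !big_cons {1 3}/A' eqxx.
  by rewrite (eq_big_seq _ (A's C)) (eq_big_seq (P \o A)) => [//|j /(A's C) /= ->].
rewrite setIC PE// muleC; congr (_ * _).
by have := PE setT (FT i); rewrite setTI probability_setT mul1e.
Qed.

End cylinders.
End independence.

(** * Integration over independent random variables *)

Section integral_independent.
Local Open Scope ereal_scope.
Context d (T : measurableType d) (R : realType) (P : probability T R).

Lemma ge0_integral_same_law d' (T' : measurableType d') (X Y : T -> T')
    (f : T' -> \bar R) :
  measurable_fun setT X -> measurable_fun setT Y -> same_law P X Y ->
  measurable_fun setT f -> (forall x, 0 <= f x) ->
  \int[P]_w f (X w) = \int[P]_w f (Y w).
Proof.
move=> mX mY XY mf f0.
rewrite -[LHS](@ge0_integral_pushforward _ _ _ _ R _ mX P setT f)//.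
rewrite -[RHS](@ge0_integral_pushforward _ _ _ _ R _ mY P setT f)//.
by apply: eq_measure_integral => A mA _; exact: XY.
Qed.

Context d1 d2 (T1 : measurableType d1) (T2 : measurableType d2).

(** Rectangles determine the product measure, so the joint law is [m1 \x m2] and Tonelli applies. *)
Lemma ge0_integral_product_law (X : T -> T1) (Y : T -> T2) (m1 : probability T1 R)
    (m2 : probability T2 R) (g : T1 * T2 -> \bar R) :
  measurable_fun setT X -> measurable_fun setT Y ->
  (forall A B, measurable A -> measurable B ->
    P (X @^-1` A `&` Y @^-1` B) = m1 A * m2 B) ->
  measurable_fun setT g -> (forall x, 0 <= g x) ->
  \int[P]_w g (X w, Y w) = \int[m1]_x \int[m2]_y g (x, y).
Proof.
move=> mX mY XY mg g0.
have mXY : measurable_fun setT (fun w => (X w, Y w)).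
  exact: measurable_fun_pair.
rewrite -[LHS](@ge0_integral_pushforward _ _ _ _ R _ mXY P setT g)//.
rewrite -[RHS](fubini_tonelli1 (m1 := m1) (m2 := m2) g)//.
apply: eq_measure_integral => A mA _; apply/esym.
apply: (@product_measure_unique _ _ _ _ _ m1 m2 (pushforward P _)) => //.
Qed.

Variables (X : T -> T1) (Y : T -> T2).
Hypotheses (mX : measurable_fun setT X) (mY : measurable_fun setT Y).
Hypothesis XY : independent2 P (preimage_set_system setT X measurable)
  (preimage_set_system setT Y measurable).

(** Tonelli for the joint law, pulled back to the sample space: the second argument is evaluated at
    a fresh outcome [w'], so that the inner integral freezes [X w]. *)
Lemma ge0_integral_independent (g : T1 * T2 -> \bar R) :
  measurable_fun setT g -> (forall x, 0 <= g x) ->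
  \int[P]_w g (X w, Y w) = \int[P]_w \int[P]_w' g (X w, Y w').
Proof.
move=> mg g0.
pose X' : {mfun T >-> T1} := HB.pack X (isMeasurableFun.Build _ _ _ _ X mX).
pose Y' : {mfun T >-> T2} := HB.pack Y (isMeasurableFun.Build _ _ _ _ Y mY).
rewrite (@ge0_integral_product_law X Y (distribution P X') (distribution P Y') g)//;
  last first.
  move=> A B mA mB; apply: XY.
    by exists A => //; rewrite setTI.
  by exists B => //; rewrite setTI.
rewrite ge0_integral_pushforward//; last 2 first.
- exact: measurable_fun_fubini_tonelli_F.
- by move=> x _; apply: integral_ge0.
apply: eq_integral => w _ /=.
rewrite ge0_integral_pushforward//.
exact: (measurableT_comp mg).
Qed.

Lemma measurable_integral_section (g : T1 * T2 -> \bar R) :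
  measurable_fun setT g -> (forall x, 0 <= g x) ->
  measurable_fun setT (fun x => \int[P]_w g (x, Y w)).
Proof.
move=> mg g0.
apply: (@measurable_fun_fubini_tonelli_F _ _ T1 T R P (fun xw => g (xw.1, Y xw.2))) => //.
apply: (measurableT_comp mg); apply: measurable_fun_pair => //.
exact: measurableT_comp.
Qed.

End integral_independent.

(** * Circular complex Gaussian noise *)

Section complex_normal.
Local Open Scope ereal_scope.
Context d (T : measurableType d) (R : realType) (P : probability T R).
Variables (v : R) (Z : T -> R[i]).
Hypotheses (v_gt0 : (0 < v)%R) (mZ : measurable_fun setT Z).
Hypothesis Z_normal : complex_normal P v Z.

Let s := Num.sqrt (v / 2).
Local Notation N := (normal_prob 0 s).

Let s_gt0 : (0 < s)%R. Proof. by rewrite sqrtr_gt0 divr_gt0. Qed.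

(** Each coordinate has variance v / 2, so the denominator of the one-dimensional exponent is [v]
    itself. *)
Let s2E : (s ^+ 2 *+ 2)%R = v.
Proof. by rewrite /s sqr_sqrtr ?divr_ge0 ?ltW// -mulr_natr divfK. Qed.

Lemma ge0_integral_complex_normal (f : R[i] -> \bar R) :
  measurable_fun setT f -> (forall x, 0 <= f x) ->
  \int[P]_w f (Z w) = \int[N]_a \int[N]_b f (Complex a b).
Proof.
move=> mf f0; have /measurable_funReIm[mr mi] := mZ.
pose g (x : R * R) := f (Complex x.1 x.2).
transitivity (\int[P]_w g (complex.Re (Z w), complex.Im (Z w))).
  by apply: eq_integral => w _; rewrite /g/=; case: (Z w).
apply: (ge0_integral_product_law (m1 := N) (m2 := N) (g := g) mr mi) => //;
  last by move=> x; exact: f0.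
apply: (measurableT_comp mf); apply/measurable_funReIm; split => /=.
  exact: measurable_fst.
exact: measurable_snd.
Qed.

Lemma measurable_Complex (a : R) :
  measurable_fun setT (fun b : R => Complex a b).
Proof. by apply/measurable_funReIm; split => /=. Qed.

Lemma measurable_integral_Complex (f : R[i] -> \bar R) :
  measurable_fun setT f -> (forall x, 0 <= f x) ->
  measurable_fun setT (fun a : R => \int[N]_b f (Complex a b)).
Proof.
move=> mf f0.
apply: (@measurable_fun_fubini_tonelli_F _ _ _ _ R N
  (fun x => f (Complex x.1 x.2))) => //.
apply: (measurableT_comp mf); apply/measurable_funReIm; split => /=.
  exact: measurable_fst.
exact: measurable_snd.
Qed.

(** The squared modulus splits into coordinates and the weight into a product, so the real formula
    is applied to the imaginary part inside and to the real part outside. *)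
Lemma ge0_integral_complex_normal_translation (c : R[i]) (f : R[i] -> \bar R) :
  measurable_fun setT f -> (forall x, 0 <= f x) ->
  \int[P]_w (f (c + Z w)%R *
    (expR (- ((sqmod (c + Z w) - sqmod (Z w)) / v)))%:E) = \int[P]_w f (Z w).
Proof.
move=> mf f0.
have mt : measurable_fun setT (fun u : R[i] => c + u)%R.
  by apply: measurable_complexD => //; exact: measurable_cst.
have me : measurable_fun setT (fun u : R[i] =>
    (expR (- ((sqmod (c + u) - sqmod u) / v)))%:E).
  apply/measurable_EFinP/measurableT_comp => //; apply: measurable_funN.
  apply: measurable_funM => //; apply: measurable_funB; first exact: measurable_sqmod.
  exact: (@measurable_sqmod R _ _ id).
pose h (u : R[i]) := f (c + u)%R * (expR (- ((sqmod (c + u) - sqmod u) / v)))%:E.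
rewrite [LHS](ge0_integral_complex_normal (f := h)); last 2 first.
- by apply: emeasurable_funM => //; exact: (measurableT_comp mf).
- by move=> u; rewrite /h mule_ge0// lee_fin expR_ge0.
rewrite (ge0_integral_complex_normal mf f0).
case: c @h mt me => c1 c2 h mt me.
pose F (a : R) := \int[N]_b f (Complex a b).
pose e (c a : R) := (expR (- (((c + a) ^+ 2 - a ^+ 2) / (s ^+ 2 *+ 2))))%R.
transitivity (\int[N]_a (F (c1 + a)%R * (e c1 a)%:E)).
  apply: eq_integral => a _.
  have mfa : measurable_fun setT (fun b : R => f (Complex (c1 + a)%R b)).
    exact: (measurableT_comp mf (measurable_Complex _)).
  have ec_ge0 : 0 <= (e c1 a)%:E by rewrite lee_fin expR_ge0.
  rewrite muleC -(ge0_integralZl N measurableT mfa (fun b _ => f0 _) ec_ge0).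
  rewrite -(@ge0_integral_normal_translation R s s_gt0 c2
    (fun b => (e c1 a)%:E * f (Complex (c1 + a)%R b))); last 2 first.
  - by apply: emeasurable_funM => //; exact: measurable_cst.
  - by move=> b; rewrite mule_ge0// lee_fin expR_ge0.
  apply: eq_integral => b _; rewrite /h muleAC muleC; congr (_ * _).
  rewrite /e s2E -EFinM -expRD; congr (expR _)%:E; rewrite /sqmod /=.
  ring.
rewrite ge0_integral_normal_translation//.
- exact: measurable_integral_Complex.
- by move=> a; apply: integral_ge0.
Qed.

(** The two coordinates are reflected one at a time. This symmetry is what [integral_dotc_eq0] asks
    of the noise. *)
Lemma same_law_complex_normal_opp : same_law P Z (fun w => - Z w)%R.
Proof.
move=> A mA.
have mone : measurable_fun setT (fun u : R[i] => (\1_A u)%:E : \bar R).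
  by apply/measurable_EFinP; exact: measurable_indic.
have one_ge0 (u : R[i]) : 0 <= (\1_A u)%:E :> \bar R by rewrite lee_fin.
have PE (X : T -> R[i]) : measurable_fun setT X ->
    P (X @^-1` A) = \int[P]_w (\1_A (X w))%:E.
  move=> mX; rewrite -[X in P X]setIT -(integral_indic P measurableT)//.
  by rewrite -[X in measurable X]setTI; exact: mX.
have mo := @measurable_complex_opp R.
rewrite !PE//; last exact: (measurableT_comp mo mZ).
rewrite (ge0_integral_complex_normal mone one_ge0).
rewrite (ge0_integral_complex_normal (f := fun u => (\1_A (- u)%R)%:E)
  (measurableT_comp mone mo) (fun u => one_ge0 (- u)%R)).
pose F (a : R) := \int[N]_b (\1_A (Complex a b))%:E.
rewrite -(@ge0_integral_normal_opp R s s_gt0 F); last 2 first.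
- exact: (measurable_integral_Complex mone).
- by move=> a; exact: integral_ge0.
apply: eq_integral => a _.
rewrite /F -(@ge0_integral_normal_opp R s s_gt0
  (fun b => (\1_A (Complex (- a)%R b))%:E))//.
exact: (measurableT_comp mone (measurable_Complex _)).
Qed.

Lemma complex_normal_sqmod_lty : \int[P]_w (sqmod (Z w))%:E < +oo.
Proof.
rewrite (ge0_integral_complex_normal (f := fun u => (sqmod u)%:E)); last 2 first.
- by apply/measurable_EFinP; exact: (@measurable_sqmod R _ _ id).
- by move=> u; rewrite lee_fin sqmod_ge0.
have msqr : measurable_fun setT (fun b : R => (b ^+ 2)%:E).
  by apply/measurable_EFinP; exact: measurable_funX.
have sqr_ge0E (b : R) : 0 <= (b ^+ 2)%:E by rewrite lee_fin sqr_ge0.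
under eq_integral => a _ do under eq_integral => b _ do rewrite /sqmod/= EFinD.
under eq_integral => a _ do rewrite ge0_integralD// integral_cst//=
  probability_setT mule1.
rewrite ge0_integralD//; last by move=> a _; exact: integral_ge0.
rewrite integral_cst//= probability_setT mule1.
by rewrite lte_add_pinfty// integral_normal_sqr_lty.
Qed.

End complex_normal.

Section orthogonality.
Local Open Scope ereal_scope.
Context d (T : measurableType d) (R : realType) (P : probability T R).
Variables X Y : T -> R[i].
Hypotheses (mX : measurable_fun setT X) (mY : measurable_fun setT Y).
Hypotheses (X2 : \int[P]_w (sqmod (X w))%:E < +oo)
  (Y2 : \int[P]_w (sqmod (Y w))%:E < +oo).

Lemma integrable_dotc : P.-integrable setT (fun w => (dotc (X w) (Y w))%:E).
Proof.
have mXY : measurable_fun setT (fun w => dotc (X w) (Y w)).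
  exact: measurable_dotc.
apply/integrableP; split; first exact/measurable_EFinP.
apply: (@le_lt_trans _ _ (\int[P]_w ((sqmod (X w))%:E + (sqmod (Y w))%:E))).
  apply: ge0_le_integral => //=.
  - exact/measurable_EFinP/measurableT_comp.
  - by apply: emeasurable_funD; exact/measurable_EFinP/measurable_sqmod.
  - by move=> w _; rewrite -EFinD lee_fin normr_dotc_le.
rewrite ge0_integralD//; last 4 first.
- by move=> w _; rewrite lee_fin sqmod_ge0.
- exact/measurable_EFinP/measurable_sqmod.
- by move=> w _; rewrite lee_fin sqmod_ge0.
- exact/measurable_EFinP/measurable_sqmod.
exact: lte_add_pinfty.
Qed.

Hypothesis XY : independent2 P (preimage_set_system setT X measurable)
  (preimage_set_system setT Y measurable).
Hypothesis Y_sym : same_law P Y (fun w => - Y w)%R.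

(* By symmetry of Y the positive and negative parts of the inner product have
   the same integral. *)
Lemma integral_dotc_eq0 : \int[P]_w (dotc (X w) (Y w))%:E = 0.
Proof.
pose g (x : R[i] * R[i]) : \bar R := (dotc x.1 x.2)%:E.
have mg : measurable_fun setT g.
  by apply/measurable_EFinP/measurable_dotc; [exact: measurable_fst|exact: measurable_snd].
pose gp := g^\+; have mgp : measurable_fun setT gp by exact: measurable_funepos.
have gp0 x : 0 <= gp x by exact: funepos_ge0.
have mo := @measurable_complex_opp R.
have gn x : g^\- x = gp (x.1, - x.2)%R.
  by rewrite /gp funenegE funeposE /g/= dotcNr EFinN.
have -> : \int[P]_w (dotc (X w) (Y w))%:E =
   \int[P]_w gp (X w, Y w) - \int[P]_w gp (X w, - Y w)%R.
  rewrite integralE; congr (_ - _).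
    by apply: eq_integral => w _; rewrite /gp !funeposE.
  by apply: eq_integral => w _; rewrite -[RHS](gn (X w, Y w)) !funenegE.
suff -> : \int[P]_w gp (X w, - Y w)%R = \int[P]_w gp (X w, Y w).
  (* Equal parts cancel only when finite; finiteness comes from the second moments through
     [integrable_dotc]. *)
  rewrite subee// ge0_fin_numE; last exact: integral_ge0.
  have /integrableP[_] := integrable_dotc.
  apply: le_lt_trans; apply: ge0_le_integral => //.
  - exact: (measurableT_comp mgp (measurable_fun_pair mX mY)).
  - by apply: (measurableT_comp _ (measurableT_comp mg (measurable_fun_pair mX mY))).
  - by move=> w _; rewrite /gp funeposE /g/= ge_max lee_abs lee_fin normr_ge0.
pose gpo (x : R[i] * R[i]) := gp (x.1, - x.2)%R.
have mgpo : measurable_fun setT gpo.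
  apply: (measurableT_comp mgp); apply: measurable_fun_pair => //.
  exact: (measurableT_comp mo).
rewrite (ge0_integral_independent mX mY XY (g := gp))//.
rewrite (ge0_integral_independent mX mY XY (g := gpo))//; last by move=> x; exact: gp0.
apply: eq_integral => w _; rewrite /gpo/=.
rewrite -(@ge0_integral_same_law _ _ _ P _ _ _ _ (fun u => gp (X w, u)) _ _ Y_sym)//.
- exact: (measurableT_comp mo mY).
- by apply: (measurableT_comp mgp); exact: measurable_fun_pair.
Qed.

End orthogonality.

(** * Measurability and independence of the past of a run *)

(* Measurability with respect to <<s G>> is measurability on
   [g_sigma_algebraType G]; a run of a code on Omega is literally a run on that
   type, so that the lemmas on [received] below also apply to sub-sigma-algebras. *)
Section sub_sigma_algebra.
Local Open Scope ereal_scope.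
Context d (T : measurableType d) (R : realType) (P : probability T R).

Lemma preimage_set_system_comp_sub (T0 : Type) d1 d2 (T1 : measurableType d1)
    (T2 : measurableType d2) (X : T0 -> T1) (f : T1 -> T2) :
  measurable_fun setT f ->
  preimage_set_system setT (f \o X) measurable `<=`
  preimage_set_system setT X measurable.
Proof.
move=> mf _ [A mA <-]; exists (f @^-1` A); last by [].
by rewrite -[X in measurable X]setTI; exact: mf.
Qed.

Lemma sub_sigma_measurable_fun d2 (T2 : measurableType d2) (G : set (set T))
    (X : T -> T2) :
  preimage_set_system setT X measurable `<=` <<s G >> ->
  measurable_fun (setT : set (g_sigma_algebraType G)) X.
Proof. by move=> XG _ A mA; apply: XG; exists A. Qed.

Context d2 (T2 : measurableType d2).
Variables (G : set (set T)) (Y : T -> T2).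
Hypotheses (mG : G `<=` measurable) (mY : measurable_fun setT Y).
Hypothesis GY : independent2 P <<s G >> (preimage_set_system setT Y measurable).
Variable g : g_sigma_algebraType G * T2 -> \bar R.
Hypotheses (mg : measurable_fun setT g) (g0 : forall x, 0 <= g x).

(** The identity onto the coarser measurable space is a random variable that generates exactly
    [<<s G>>], so the formula for two independent variables applies to it. *)
Lemma ge0_integral_sub_sigma :
  \int[P]_w g (w, Y w) = \int[P]_w \int[P]_w' g (w, Y w').
Proof.
have mid : measurable_fun setT (id : T -> g_sigma_algebraType G).
  move=> _ A sGA; rewrite setTI preimage_id.
  by apply: sGA; split => //; exact: sigma_algebra_measurable.
apply: (ge0_integral_independent mid mY _ mg g0).
by move=> A B [A' mA' <-] YB; rewrite setTI preimage_id; exact: GY.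
Qed.

End sub_sigma_algebra.

(** * Measurability of a run for a fixed message *)

Section code_measurability.
Context d (T : measurableType d) (R : realType) (k n M : nat).
Variables (h : 'I_k -> 'I_k -> nat -> T -> R[i]) (z : 'I_k -> nat -> T -> R[i]).
Variable c : network_code R k n M.

Lemma measurable_rcons (t : nat) (f : T -> t.-tuple R[i]) (g : T -> R[i]) :
  measurable_fun setT f -> measurable_fun setT g ->
  measurable_fun setT (fun w => [tuple of rcons (f w) (g w)]).
Proof.
move=> mf mg; apply/measurable_fun_tnthP => i.
have [it|it] := ltnP i t.
  rewrite (_ : _ \o _ = fun w => tnth (f w) (Ordinal it)).
    exact: (measurableT_comp (measurable_tnth _)).
  by apply/funext => w /=; rewrite !(tnth_nth 0)/= nth_rcons size_tuple it.
rewrite (_ : _ \o _ = g)//; apply/funext => w /=.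
rewrite (tnth_nth 0)/= nth_rcons size_tuple ltnNge it/=.
by rewrite eqn_leq it -ltnS ltn_ord.
Qed.

Lemma measurable_transmit (i : 'I_k) (t m : nat) :
  measurable_fun setT (@transmit R k n M c i t m).
Proof.
rewrite /transmit; case: (_ == _); first exact: measurable_cst.
exact: relay_measurable.
Qed.

Definition signal (j : 'I_k) (m t : nat) (w : T) : R[i] :=
  \sum_(i < k) h i j t w * sent h z c i t (m, w).

Variable m : nat.

(** The hypotheses concern times before [t] only, so that they can be met on the sigma-algebra of a
    past. *)
Lemma measurable_received t :
  (forall i j s, (s < t)%N -> measurable_fun setT (h i j s)) ->
  (forall j s, (s < t)%N -> measurable_fun setT (z j s)) ->
  forall j, measurable_fun setT (fun w => received h z c t (m, w) j).
Proof.
elim: t => [|t ih] mh mz j /=; first exact: measurable_cst.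
have mr i : measurable_fun setT (fun w => received h z c t (m, w) i).
  apply: ih => [i' j' s st|j' s st]; first exact/mh/ltnW.
  exact/mz/ltnW.
apply: measurable_rcons => //; apply: measurable_complexD; last exact: mz.
apply: measurable_complex_sum => i; apply: measurable_complexM; first exact: mh.
exact: (measurableT_comp (@measurable_transmit i t m) (mr i)).
Qed.

Lemma measurable_sent t :
  (forall i j s, (s < t)%N -> measurable_fun setT (h i j s)) ->
  (forall j s, (s < t)%N -> measurable_fun setT (z j s)) ->
  forall i, measurable_fun setT (fun w => sent h z c i t (m, w)).
Proof.
move=> mh mz i; apply: (measurableT_comp (@measurable_transmit i t m)).
exact: measurable_received.
Qed.

Lemma measurable_signal t :
  (forall i j s, (s <= t)%N -> measurable_fun setT (h i j s)) ->
  (forall j s, (s < t)%N -> measurable_fun setT (z j s)) ->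
  forall j, measurable_fun setT (signal j m t).
Proof.
move=> mh mz j; apply: measurable_complex_sum => i.
apply: measurable_complexM; first exact: mh.
by apply: measurable_sent => // i' j' s st; apply: mh; exact: ltnW.
Qed.

End code_measurability.

(** * The two pasts and their independence of the present *)

Section network.
Local Open Scope ereal_scope.
Context d (Omega : measurableType d) (R : realType) (P : probability Omega R).
Variables (k : nat) (N0 : R).
Variables (h : 'I_k -> 'I_k -> nat -> Omega -> R[i])
          (z : 'I_k -> nat -> Omega -> R[i]).
Hypothesis network : fading_network P N0 h z.

Let mh := fading_measurable network.
Let mz := noise_measurable network.
Let N0_gt0 := noise_level_gt0 network.

Lemma generated_sigma_sub d' (T' : measurableType d') (I : Type)
    (X : I -> Omega -> T') :
  (forall i, measurable_fun setT (X i)) -> generated_sigma X `<=` measurable.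
Proof.
move=> mX; apply: smallest_sub; first exact: sigma_algebra_measurable.
by move=> A [i _ [B mB <-]]; exact: mX.
Qed.

Lemma sub_generated_sigma d' (T' : measurableType d') (I : Type)
    (X : I -> Omega -> T') i :
  preimage_set_system setT (X i) measurable `<=` generated_sigma X.
Proof. by move=> A XA; apply: sub_sigma_algebra; exists i. Qed.

Lemma generated_sigma_setI_closed d' (T' : measurableType d') (I : Type)
    (X : I -> Omega -> T') : setI_closed (generated_sigma X).
Proof.
by move=> A B XA XB; apply: (@measurableI _ (g_sigma_algebraType _)).
Qed.

Lemma generated_sigmaT d' (T' : measurableType d') (I : Type)
    (X : I -> Omega -> T') : generated_sigma X setT.
Proof. exact: (@measurableT _ (g_sigma_algebraType _)). Qed.

Lemma preimage_set_system_setI_closed d' (T' : measurableType d')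
    (X : Omega -> T') : setI_closed (preimage_set_system setT X measurable).
Proof.
move=> _ _ [A mA <-] [B mB <-]; exists (A `&` B); first exact: measurableI.
by rewrite preimage_setI !setTI.
Qed.

Lemma preimage_set_systemT d' (T' : measurableType d') (X : Omega -> T') :
  preimage_set_system setT X measurable setT.
Proof. by exists setT => //; rewrite setTI preimage_setT. Qed.

Lemma preimage_set_system_sub d' (T' : measurableType d') (X : Omega -> T') :
  measurable_fun setT X -> preimage_set_system setT X measurable `<=` measurable.
Proof. by move=> mX _ [A mA <-]; exact: mX. Qed.

Let noise (jt : 'I_k * nat) := z jt.1 jt.2.
Let noise_system (jt : 'I_k * nat) : set (set Omega) :=
  preimage_set_system setT (z jt.1 jt.2) measurable.
Let fading (ijt : 'I_k * 'I_k * nat) := h ijt.1.1 ijt.1.2 ijt.2.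
Let fading_system (t : nat) : set (set Omega) :=
  generated_sigma (fun ij : 'I_k * 'I_k => h ij.1 ij.2 t).

(** The fading at all times is included, the present and the future as well. Both pasts are kept as
    pi-systems, on which independence is checked. *)
Definition noise_past t : set (set Omega) :=
  setI_system (cylinders noise_system
    [seq (l, s) | l <- enum 'I_k, s <- iota 0 t]) (generated_sigma fading).

Definition fading_past t : set (set Omega) :=
  setI_system (cylinders fading_system (iota 0 t)) (generated_sigma noise).

Let noise_systemI jt : setI_closed (noise_system jt).
Proof. exact: preimage_set_system_setI_closed. Qed.
Let noise_systemT jt : noise_system jt setT.
Proof. exact: preimage_set_systemT. Qed.
Let noise_system_sub jt : noise_system jt `<=` measurable.
Proof. exact: preimage_set_system_sub. Qed.
Let fading_systemI t : setI_closed (fading_system t).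
Proof. exact: generated_sigma_setI_closed. Qed.
Let fading_systemT t : fading_system t setT.
Proof. exact: generated_sigmaT. Qed.
Let fading_system_sub t : fading_system t `<=` measurable.
Proof. exact: generated_sigma_sub. Qed.

Let noise_indices_uniq t : uniq [seq (l, s) | l <- enum 'I_k, s <- iota 0 t].
Proof.
by apply: allpairs_uniq => [||[] ? ? [] ? ? _ _ /=//]; [exact: enum_uniq|exact: iota_uniq].
Qed.

Let mem_noise_indices t j s :
  ((j, s) \in [seq (l, s) | l <- enum 'I_k, s <- iota 0 t]) = (s < t)%N.
Proof.
apply/allpairsP/idP => [[[l u]/= [_ + [_ ->]]]|st]; first by rewrite mem_iota.
by exists (j, s); rewrite /= mem_enum mem_iota.
Qed.

Let fading_sub : generated_sigma fading `<=` measurable.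
Proof. by apply: generated_sigma_sub => i; exact: mh. Qed.
Let noise_sub : generated_sigma noise `<=` measurable.
Proof. by apply: generated_sigma_sub => i; exact: mz. Qed.

Lemma noise_past_sub t : noise_past t `<=` measurable.
Proof.
apply: setI_system_measurable; first exact: cylinders_measurable.
exact: fading_sub.
Qed.

Lemma fading_past_sub t : fading_past t `<=` measurable.
Proof.
apply: setI_system_measurable; first exact: cylinders_measurable.
exact: noise_sub.
Qed.

(** The noise at [(j, t)] is independent of all earlier noise, and noise as a whole is independent
    of fading; [independent2_exchange] combines the two facts. *)
Lemma noise_past_independent j t :
  independent2 P <<s noise_past t >>
    (preimage_set_system setT (z j t) measurable).
Proof.
apply: independent2_exchange.
- exact: cylinders_setI_closed.
- exact: cylindersT.
- exact: generated_sigma_setI_closed.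
- exact: generated_sigmaT.
- exact: preimage_set_systemT.
- exact: cylinders_measurable.
- exact: preimage_set_system_sub.
- exact: fading_sub.
- apply: (@cylinders_independent _ _ _ _ _ noise_system _ _ (j, t)) => //.
  + exact: (noise_independent network).
  + by rewrite mem_noise_indices ltnn.
- apply: (independent2_sub _ _ (noise_fading_independent network)) => //.
  move=> _ [A [B BF <-] [C CF <-]]; apply: generated_sigma_setI_closed.
    apply: big_ind; first exact: generated_sigmaT.
      exact: generated_sigma_setI_closed.
    by move=> i _; exact: (@sub_generated_sigma _ _ _ noise i _ (BF i)).
  exact: (@sub_generated_sigma _ _ _ noise (j, t)).
Qed.

Lemma fading_past_independent t :
  independent2 P <<s fading_past t >> (fading_system t).
Proof.
apply: independent2_exchange.
- exact: cylinders_setI_closed.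
- exact: cylindersT.
- exact: generated_sigma_setI_closed.
- exact: generated_sigmaT.
- exact: generated_sigmaT.
- exact: cylinders_measurable.
- exact: fading_system_sub.
- exact: noise_sub.
- apply: cylinders_independent => //.
  + exact: (fading_time_independent network).
  + exact: iota_uniq.
  + by rewrite mem_iota add0n ltnn.
- have sub s : fading_system s `<=` generated_sigma fading.
    apply: smallest_sub; first exact: smallest_sigma_algebra.
    by move=> A [ij _ XA]; exact: (@sub_generated_sigma _ _ _ fading (ij, s)).
  apply: independent2C; apply: (independent2_sub _ _ (noise_fading_independent network)) => //.
  move=> _ [A [B BF <-] [C CF <-]]; apply: generated_sigma_setI_closed.
    apply: big_ind; first exact: generated_sigmaT.
      exact: generated_sigma_setI_closed.
    by move=> i _; exact: (sub _ _ (BF i)).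
  exact: (sub t).
Qed.

Lemma noise_past_fading t i j s :
  measurable_fun (setT : set (g_sigma_algebraType (noise_past t))) (h i j s).
Proof.
apply: sub_sigma_measurable_fun => A hA; apply: sub_sigma_algebra.
apply: sub_setI_systemr; first exact: cylindersT.
exact: (@sub_generated_sigma _ _ _ fading (i, j, s)).
Qed.

Lemma noise_past_noise t j s : (s < t)%N ->
  measurable_fun (setT : set (g_sigma_algebraType (noise_past t))) (z j s).
Proof.
move=> st; apply: sub_sigma_measurable_fun => A zA; apply: sub_sigma_algebra.
apply: sub_setI_systeml; first exact: generated_sigmaT.
apply: (@sub_cylinders _ _ _ _ noise_systemT _ (j, s)) => //.
by rewrite mem_noise_indices.
Qed.

Lemma fading_past_noise t j s :
  measurable_fun (setT : set (g_sigma_algebraType (fading_past t))) (z j s).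
Proof.
apply: sub_sigma_measurable_fun => A zA; apply: sub_sigma_algebra.
apply: sub_setI_systemr; first exact: cylindersT.
exact: (@sub_generated_sigma _ _ _ noise (j, s)).
Qed.

Lemma fading_past_fading t i j s : (s < t)%N ->
  measurable_fun (setT : set (g_sigma_algebraType (fading_past t))) (h i j s).
Proof.
move=> st; apply: sub_sigma_measurable_fun => A zA; apply: sub_sigma_algebra.
apply: sub_setI_systeml; first exact: generated_sigmaT.
apply: (@sub_cylinders _ _ _ fading_system fading_systemT _ s).
- exact: iota_uniq.
- by rewrite mem_iota.
exact: (@sub_generated_sigma _ _ _ (fun ij : 'I_k * 'I_k => h ij.1 ij.2 s) (i, j)).
Qed.

End network.

(** * Change of measure and the converse at one receiver *)

Section converse.
Local Open Scope ereal_scope.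
Context d (Omega : measurableType d) (R : realType) (P : probability Omega R).
Variables (k : nat) (N0 : R).
Variables (h : 'I_k -> 'I_k -> nat -> Omega -> R[i])
          (z : 'I_k -> nat -> Omega -> R[i]).
Hypothesis network : fading_network P N0 h z.

Let mh := fading_measurable network.
Let mz := noise_measurable network.
Let N0_gt0 := noise_level_gt0 network.

Definition power (X : Omega -> R[i]) : \bar R := \int[P]_w (sqmod (X w))%:E.

Lemma power_ge0 X : 0 <= power X.
Proof. by apply: integral_ge0 => w _; rewrite lee_fin sqmod_ge0. Qed.

Let measurable_sqmod_fin : measurable_fun setT (fun u : R[i] => (sqmod u)%:E).
Proof. by apply/measurable_EFinP; exact: (@measurable_sqmod R _ _ id). Qed.

(** [gain] is defined at time 0; stationarity carries it to every [t]. *)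
Lemma fading_power i j t : power (h i j t) = gain P h i j.
Proof.
rewrite /gain expectation.unlock.
apply: (ge0_integral_same_law (f := fun u => (sqmod u)%:E)) => //.
- exact: (fading_stationary network).
- by move=> u; rewrite lee_fin sqmod_ge0.
Qed.

Lemma fading_opp i j t : same_law P (h i j t) (fun w => - h i j t w)%R.
Proof.
(* Circular symmetry is stated off the diagonal; on it the coefficient is 0, its own opposite. *)
have [<-|ij] := eqVneq i j.
  move=> A mA; congr (P _); apply/seteqP.
  by split => w /=; rewrite (fading_diag network) oppr0.
have := fading_circular network t ij (u := -1)%R.
rewrite normrN1 => /(_ erefl) hs A mA; rewrite (hs A mA).
by congr (P _); apply/seteqP; split => w /=; rewrite mulN1r.
Qed.

(** Pythagoras for deterministic inputs: links to the same receiver are pairwise independent and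
    symmetric, hence orthogonal. *)
Lemma fading_combination_power j t (x : 'I_k -> R[i]) :
  power (fun w => \sum_(i < k) h i j t w * x i)%R =
  \sum_(i < k) gain P h i j * (sqmod (x i))%:E.
Proof.
pose X i w := (h i j t w * x i)%R.
have mX i : measurable_fun setT (X i).
  by apply: measurable_complexM => //; exact: measurable_cst.
have XP i : power (X i) = gain P h i j * (sqmod (x i))%:E.
  rewrite -(fading_power i j t) muleC /power -ge0_integralZl//.
  - by apply: eq_integral => w _; rewrite sqmodM mulrC EFinM.
  - by apply/measurable_EFinP/measurable_sqmod.
  - by move=> w _; rewrite lee_fin sqmod_ge0.
  - by rewrite lee_fin sqmod_ge0.
have Xlty i : power (X i) < +oo.
  by rewrite XP lte_mul_pinfty// ?ltry ?(fading_gain_finite network)//;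
    rewrite -?(fading_power i j t) ?ge0_fin_numE ?power_ge0// fading_power
      (fading_gain_finite network).
have ortho i l : i != l -> \int[P]_w (dotc (X i w) (X l w))%:E = 0.
  move=> il; apply: integral_dotc_eq0 => //; try exact: Xlty.
    have mM (a : R[i]) : measurable_fun setT (fun u : R[i] => u * a)%R.
      by apply: measurable_complexM => //; exact: measurable_cst.
    apply: (independent2_sub (preimage_set_system_comp_sub (mM (x i)))
      (preimage_set_system_comp_sub (mM (x l)))).
    by apply: (fading_link_independent network); rewrite xpair_eqE (negbTE il).
  move=> A mA.
  have mM : measurable_fun setT (fun u : R[i] => u * x l)%R.
    by apply: measurable_complexM => //; exact: measurable_cst.
  have mA' : measurable ((fun u : R[i] => u * x l)%R @^-1` A).
    by rewrite -[Y in measurable Y]setTI; exact: mM.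
  have := fading_opp l j t mA'; rewrite /preimage/= => ->.
  by congr (P _); apply/seteqP; split => w; rewrite /= /X mulNr.
have iX i l : P.-integrable setT (fun w => (dotc (X i w) (X l w))%:E).
  by apply: integrable_dotc => //; exact: Xlty.
rewrite /power.
under eq_integral => w _ do rewrite -dotcc dotc_suml -sumEFin.
rewrite integral_sum//; last first.
  move=> i; under eq_fun => w do rewrite dotc_sumr -sumEFin.
  by apply: (integrable_sum measurableT) => l _; exact: iX.
apply: eq_bigr => i _.
under eq_integral => w _ do rewrite dotc_sumr -sumEFin.
rewrite integral_sum//; last by move=> l; exact: iX.
rewrite (bigD1 i)//= big1 ?adde0 => [|l li].
  by rewrite -XP.
by rewrite ortho// eq_sym.
Qed.

Section run.
Variables (n M : nat) (c : network_code R k n M).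

(** Given the fading past, the inputs are frozen and [fading_combination_power] applies to the
    present coefficients. *)
Lemma signal_power j m t :
  power (signal h z c j m t) =
  \sum_(i < k) gain P h i j * power (fun w => sent h z c i t (m, w)).
Proof.
(* The present fading is handled like the past, as a sigma-algebra on [Omega]; the integrand is then
   [g] on the diagonal. *)
pose gens : set (set Omega) :=
  \bigcup_(ij : 'I_k * 'I_k) preimage_set_system setT (h ij.1 ij.2 t) measurable.
pose T1 := g_sigma_algebraType (fading_past h z t).
pose T2 := g_sigma_algebraType gens.
have gens_sub : gens `<=` measurable by move=> A [ij _ [B mB <-]]; exact: mh.
have mid : measurable_fun setT (id : Omega -> T2).
  move=> _ A sGA; rewrite setTI preimage_id.
  by apply: sGA; split => //; exact: sigma_algebra_measurable.
pose g (x : T1 * T2) : \bar R :=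
  (sqmod (\sum_(i < k) h i j t x.2 * sent h z c i t (m, x.1 : Omega)))%:E.
have ms i : measurable_fun setT (fun w : T1 => sent h z c i t (m, w : Omega)).
  apply: (@measurable_sent _ T1 R k n M h z c m t).
    by move=> i' j' s st; exact: fading_past_fading.
  by move=> j' s _; exact: fading_past_noise.
have mhT i : measurable_fun setT (h i j t : T2 -> R[i]).
  apply: sub_sigma_measurable_fun => A hA; apply: sub_sigma_algebra.
  by exists (i, j).
have mg : measurable_fun setT g.
  apply: (measurableT_comp measurable_sqmod_fin).
  apply: measurable_complex_sum => i; apply: measurable_complexM.
    exact: (measurableT_comp (mhT i) measurable_snd).
  exact: (measurableT_comp (ms i) measurable_fst).
have g0 x : 0 <= g x by rewrite lee_fin sqmod_ge0.
have ind : independent2 P <<s fading_past h z t >>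
    (preimage_set_system setT (id : Omega -> T2) measurable).
  move=> A B FA [B' mB' <-]; rewrite setTI preimage_id.
  exact: (fading_past_independent network FA mB').
transitivity (\int[P]_w g (w, w)); first by [].
rewrite (ge0_integral_sub_sigma (fading_past_sub network (t := t)) mid ind mg g0).
have msent i : measurable_fun setT (fun w => (sqmod (sent h z c i t (m, w)))%:E).
  by apply/measurable_EFinP/measurable_sqmod/measurable_sent.
have gain_ge0 i : 0 <= gain P h i j by rewrite -(fading_power i j 0) power_ge0.
transitivity (\int[P]_w
    \sum_(i < k) gain P h i j * (sqmod (sent h z c i t (m, w)))%:E).
  apply: eq_integral => w _.
  exact: (fading_combination_power j t (fun i => sent h z c i t (m, w))).
rewrite ge0_integral_sum//; last 2 first.
- by move=> i; apply: emeasurable_funM => //; exact: measurable_cst.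
- by move=> i w _; rewrite mule_ge0// lee_fin sqmod_ge0.
apply: eq_bigr => i _; rewrite ge0_integralZl// => w _.
by rewrite lee_fin sqmod_ge0.
Qed.

Definition output (j : 'I_k) (m t : nat) (w : Omega) : t.-tuple R[i] :=
  received h z c t (m, w) j.

(** Log-likelihood ratio of the outputs: their Gaussian density given the signals against that of
    pure noise, the normalising constants cancelling. *)
Definition llr (j : 'I_k) (m t : nat) (w : Omega) : R :=
  (\sum_(s < t) (sqmod (signal h z c j m s w + z j s w) - sqmod (z j s w)) / N0)%R.

Lemma measurable_output j m t : measurable_fun setT (output j m t).
Proof. exact: measurable_received. Qed.

Let measurable_signalT m t j : measurable_fun setT (signal h z c j m t).
Proof. exact: measurable_signal. Qed.

(** [H] is an identity map in its uses; it lets the domain carry a coarser sigma-algebra. *)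
Lemma measurable_llr d' (T : measurableType d') j m t (H : T -> Omega) :
  (forall s, (s < t)%N -> measurable_fun setT (signal h z c j m s \o H)) ->
  (forall s, (s < t)%N -> measurable_fun setT (z j s \o H)) ->
  measurable_fun setT (llr j m t \o H).
Proof.
move=> ms mzH.
rewrite (_ : _ \o _ = fun w => \sum_(s < t)
  ((sqmod (signal h z c j m s (H w) + z j s (H w)) - sqmod (z j s (H w))) / N0))%R//.
apply: measurable_sum => s; apply: measurable_funM => //.
apply: measurable_funB; last exact/measurable_sqmod/mzH.
by apply: measurable_sqmod; apply: measurable_complexD; [exact: ms|exact: mzH].
Qed.

(* The exponential of [- llr] is the density of the law of pure noise with
   respect to that of the outputs of [j]: weighting by it makes the outputs
   independent of the message. *)
Lemma change_of_measure j t (F : nat -> t.-tuple R[i] -> \bar R) :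
  (forall m, measurable_fun setT (F m)) -> (forall m y, 0 <= F m y) ->
  (forall y, \sum_(m < M) F m y <= 1) ->
  \sum_(m < M) \int[P]_w
    (F m (output j m t w) * (expR (- llr j m t w))%:E) <= 1.
Proof.
elim: t F => [|t ih] F mF F0 F1.
  rewrite (le_trans _ (F1 [tuple]))//; apply: lee_sum => m _.
  rewrite (_ : (fun w => _) = cst (F m [tuple])) ?integral_cst//= ?probability_setT ?mule1//.
  by apply/funext => w /=; rewrite /llr big_ord0 oppr0 expR0 mule1.
(* The last output is replaced by pure noise and integrated out. The bound on the sum over messages
   survives, so the induction hypothesis applies to [F']. *)
pose F' m (y : t.-tuple R[i]) := \int[P]_w' F m [tuple of rcons y (z j t w')].
have mrc m : measurable_fun setT
    (fun yu : t.-tuple R[i] * R[i] => F m [tuple of rcons yu.1 yu.2]).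
  apply: (measurableT_comp (mF m)); apply: measurable_rcons.
    exact: measurable_fst.
  exact: measurable_snd.
have mF' m : measurable_fun setT (F' m).
  exact: (@measurable_integral_section _ _ _ P _ _ _ _ (z j t) (mz j t) _ (mrc m)).
apply: (le_trans _ (ih F' mF' _ _)); last 2 first.
- by move=> m y; exact: integral_ge0.
- move=> y; rewrite /F' -ge0_integral_sum//.
    apply: (@le_trans _ _ (\int[P]_w' 1)).
      apply: ge0_le_integral => //.
      - by move=> w _; apply: sume_ge0.
      - apply: emeasurable_sum => m.
        apply: (measurableT_comp (mF m)); apply: measurable_rcons => //.
    by rewrite integral_cst//= probability_setT mule1.
  move=> m; apply: (measurableT_comp (mF m)); exact: measurable_rcons.
apply: lee_sum => m _; rewrite le_eqVlt; apply/orP; left; apply/eqP.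
pose T1 := g_sigma_algebraType (noise_past h z t).
pose Y (w : T1) := output j m t w.
pose S (w : T1) := signal h z c j m t w.
pose L (w : T1) := llr j m t w.
have mY : measurable_fun setT Y.
  apply: (@measurable_received _ T1 R k n M h z c m t).
    by move=> i' j' s _; exact: noise_past_fading.
  by move=> j' s st; exact: noise_past_noise.
have mS s : (s <= t)%N ->
    measurable_fun setT (fun w : T1 => signal h z c j m s w).
  move=> st; apply: (@measurable_signal _ T1 R k n M h z c m s).
    by move=> i' j' s' _; exact: noise_past_fading.
  by move=> j' s' st'; apply: noise_past_noise; exact: leq_trans st' st.
have mL : measurable_fun setT L.
  apply: (@measurable_llr _ T1 j m t id) => s st; first exact: (mS s (ltnW st)).
  exact: noise_past_noise.
pose e (x : R[i] * R[i]) : R := (expR (- ((sqmod (x.1 + x.2) - sqmod x.2) / N0)))%R.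
have me : measurable_fun setT e.
  apply: measurableT_comp => //; apply: measurable_funN; apply: measurable_funM => //.
  apply: measurable_funB; apply: measurable_sqmod; last exact: measurable_snd.
  by apply: measurable_complexD; [exact: measurable_fst|exact: measurable_snd].
(* The past outputs, the signal and the weight so far depend on the first argument only; the second
   is the noise at time [t], over which the translation formula with shift [S w] gives [F']. *)
pose g (x : T1 * R[i]) : \bar R :=
  (expR (- L x.1))%:E * (F m [tuple of rcons (Y x.1) (S x.1 + x.2)%R] *
     (e (S x.1, x.2))%:E).
have mS1 : measurable_fun setT (fun x : T1 * R[i] => S x.1).

  exact: (measurableT_comp (mS t (leqnn t)) measurable_fst).
have mg : measurable_fun setT g.
  apply: emeasurable_funM.
    apply/measurable_EFinP/measurableT_comp => //; apply: measurable_funN.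
    exact: (measurableT_comp mL measurable_fst).
  apply: emeasurable_funM.
    apply: (measurableT_comp (mF m)); apply: measurable_rcons.
      exact: (measurableT_comp mY measurable_fst).
    by apply: measurable_complexD => //; exact: measurable_snd.
  apply/measurable_EFinP/(measurableT_comp me); apply: measurable_fun_pair => //.
have g0 x : 0 <= g x by rewrite !mule_ge0// lee_fin expR_ge0.
transitivity (\int[P]_w g (w, z j t w)).
  apply: eq_integral => w _; rewrite /g muleCA; congr (_ * _).
  rewrite -EFinM -expRD; congr (expR _)%:E.
  by rewrite /llr big_ord_recr/= opprD.
rewrite (ge0_integral_sub_sigma (noise_past_sub network (t := t)) (mz j t)
  (noise_past_independent network (j := j) (t := t)) mg g0).
apply: eq_integral => w _; rewrite /g/= ge0_integralZl//; last 2 first.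
- apply: emeasurable_funM.
    apply: (measurableT_comp (mF m)); apply: measurable_rcons => //.
    by apply: measurable_complexD.
  apply/measurable_EFinP/(measurableT_comp me); apply: measurable_fun_pair => //.
- by move=> w' _; rewrite mule_ge0// lee_fin expR_ge0.
rewrite muleC; congr (_ * _).
rewrite (ge0_integral_complex_normal_translation N0_gt0 (mz j t)
  (noise_normal network j t) (S w)
  (f := fun u => F m [tuple of rcons (output j m t w) u]))//.
by apply: (measurableT_comp (mF m)); exact: measurable_rcons.
Qed.

Section finite_power.
Variables (j : 'I_k) (m : nat).
Hypothesis signal_lty : forall t, (t < n)%N -> power (signal h z c j m t) < +oo.

Let noise_lty t : power (z j t) < +oo.
Proof. exact: (complex_normal_sqmod_lty N0_gt0 (mz j t) (noise_normal network j t)). Qed.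

Let noise_indep t : independent2 P
  (preimage_set_system setT (signal h z c j m t) measurable)
  (preimage_set_system setT (z j t) measurable).
Proof.
apply: independent2_sub (noise_past_independent network (j := j) (t := t)) => //.
move=> _ [A mA <-].
apply: (@measurable_signal _ (g_sigma_algebraType (noise_past h z t)) R k n M
  h z c m t) => //.
  by move=> i' j' s' _; exact: noise_past_fading.
by move=> j' s' st'; exact: noise_past_noise.
Qed.

(** Expanding the square cancels |z|^2; the remaining cross term integrates to 0, as the signal
    precedes the noise. *)
Let incr t w : R := (N0^-1 * sqmod (signal h z c j m t w) +
  2 / N0 * dotc (signal h z c j m t w) (z j t w))%R.

Let incrE t w : ((sqmod (signal h z c j m t w + z j t w) - sqmod (z j t w)) / N0 =
  incr t w)%R.
Proof. by rewrite sqmodD /incr; ring. Qed.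

Let integrable_signal t : (t < n)%N ->
  P.-integrable setT (fun w => (sqmod (signal h z c j m t w))%:E).
Proof.
move=> tn; apply/integrableP; split.
  by apply/measurable_EFinP/measurable_sqmod.
under eq_integral => w _ do rewrite gee0_abs ?lee_fin ?sqmod_ge0//.
exact: signal_lty.
Qed.

Let integrable_incr t : (t < n)%N ->
  P.-integrable setT (fun w => (incr t w)%:E).
Proof.
move=> tn; under eq_fun => w do rewrite /incr EFinD !EFinM.
apply: integrableD => //; apply: integrableZl => //; first exact: integrable_signal.
by apply: integrable_dotc => //; [exact: signal_lty|exact: noise_lty].
Qed.

Lemma integrable_llr t : (t <= n)%N ->
  P.-integrable setT (fun w => (llr j m t w)%:E).
Proof.
move=> tn; under eq_fun => w do rewrite /llr -sumEFin.
apply: (integrable_sum measurableT) => s _.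
under eq_fun => w do rewrite incrE.
exact/integrable_incr/(leq_trans (ltn_ord s) tn).
Qed.

Lemma integral_llr : \int[P]_w (llr j m n w)%:E =
  (N0^-1)%:E * \sum_(t < n) power (signal h z c j m t).
Proof.
under eq_integral => w _ do rewrite /llr -sumEFin.
rewrite integral_sum//; last first.
  by move=> s; under eq_fun => w do rewrite incrE; exact: integrable_incr.
rewrite ge0_sume_distrr; last by move=> s _; exact: power_ge0.
apply: eq_bigr => s _.
under eq_integral => w _ do rewrite incrE /incr EFinD.
have dotc_int : P.-integrable setT
    (fun w => (dotc (signal h z c j m s w) (z j s w))%:E).
  by apply: integrable_dotc => //; [exact: signal_lty|exact: noise_lty].
rewrite integralD//; last 2 first.
- under eq_fun => w do rewrite EFinM.
  by apply: integrableZl => //; exact: integrable_signal.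
- by under eq_fun => w do rewrite EFinM; exact: integrableZl.
under eq_integral => w _ do rewrite EFinM.
rewrite integralZl//; last exact: integrable_signal.
under [X in _ + X]eq_integral => w _ do rewrite EFinM.
rewrite [X in _ + X]integralZl//.
rewrite (integral_dotc_eq0 _ (mz j s) (signal_lty (ltn_ord s)) (noise_lty s)
  (@noise_indep s)) ?mule0 ?adde0//.
exact: (same_law_complex_normal_opp N0_gt0 (mz j s) (noise_normal network j s)).
Qed.

End finite_power.

Definition decoded (j : 'I_k) (m : nat) : set Omega :=
  [set w | decoder c j (output j m n w) = m].

Lemma measurable_decoded j m : measurable (decoded j m).
Proof.
have := measurableT_comp (decoder_measurable c j) (@measurable_output j m n).
by move=> /(_ measurableT [set m]); rewrite setTI; apply.
Qed.

(** This takes the place of Fano's inequality: a pointwise convexity bound is integrated and summed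
    over the messages, and [change_of_measure] controls both exponential terms. *)
Lemma fano j : (0 < M)%N ->
  (forall (m : 'I_M) t, (t < n)%N -> power (signal h z c j m t) < +oo) ->
  (\sum_(m < M) P (decoded j m)) * (ln M%:R)%:E <=
  M%:R%:E + (N0^-1)%:E * \sum_(m < M) \sum_(t < n) power (signal h z c j m t).
Proof.
move=> M0 fin.
have M0R : (0 < M%:R :> R)%R by rewrite ltr0n.
pose E m w : R := expR (- llr j m n w).
have mllr m : measurable_fun setT (llr j m n).
  by apply: (@measurable_llr _ Omega j m n id) => s _ /=; [exact: measurable_signalT|exact: mz].
have mE m : measurable_fun setT (E m).
  by apply: measurableT_comp => //; exact: measurable_funN.
pose D m w : R := \1_(decoded j m) w.
have mD m : measurable_fun setT (D m).
  by apply: measurable_indic; exact: measurable_decoded.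
(* The tangent inequality at [ln M%:R - llr] on the decoded event and at [- llr] off it; on the
   event the extra nonnegative [E m w] is simply added. *)
have pointwise m w :
    (1 + ln M%:R * D m w <= llr j m n w + (M%:R * (D m w * E m w) + E m w))%R.
  rewrite /D indicE; case: (_ \in _).
  - rewrite mulr1 mul1r.
    have -> : (M%:R * E m w = expR (ln M%:R - llr j m n w))%R.
      by rewrite /E expRD lnK.
    have := expR_ge1Dx (ln M%:R - llr j m n w); have := expR_ge0 (- llr j m n w).
    rewrite /E; lra.
  - rewrite !mulr0 mul0r mulr0 addr0 add0r.
    have := expR_ge1Dx (- llr j m n w); rewrite /E; lra.
(* For pure noise the decoder still outputs a single message, so the decision indicators sum to 1
   over [m]. *)
have DE_le1 : \sum_(m < M) \int[P]_w (D m w * E m w)%:E <= 1.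
  pose F m (y : n.-tuple R[i]) : \bar R := (\1_[set m] (decoder c j y))%:E.
  have mF m : measurable_fun setT (F m).
    apply/measurable_EFinP; apply: (measurableT_comp _ (decoder_measurable c j)).
    exact: measurable_indic.
  have F1 y : \sum_(m < M) F m y <= 1.
    rewrite (bigD1 (Ordinal (decoder_lt c j y)))//= big1 ?adde0.
      by rewrite /F indicE lee_fin; case: (_ \in _).
    move=> i ij; rewrite /F indicE; case: (boolP (_ \in _)) => //.
    by rewrite inE/= => yi; move: ij; rewrite -val_eqE /= yi eqxx.
  apply: le_trans (change_of_measure j mF _ F1); last by move=> m y; rewrite lee_fin.
  apply: lee_sum => m _; rewrite le_eqVlt; apply/orP; left; apply/eqP.
  by apply: eq_integral => w _; rewrite EFinM /F /D /E !indicE.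
(* The same bound for a blind uniform guess, with constant weights 1 / M. *)
have E_leM : \sum_(m < M) \int[P]_w (E m w)%:E <= M%:R%:E.
  have F1 (y : n.-tuple R[i]) : \sum_(m < M) (M%:R^-1)%:E <= 1 :> \bar R.
    by rewrite sumEFin lee_fin sumr_const card_ord -[leLHS]mulr_natl divff// gt_eqF.
  have EM (m : 'I_M) : \int[P]_w (E m w)%:E =
      M%:R%:E * \int[P]_w ((M%:R^-1)%:E * (E m w)%:E).
    rewrite ge0_integralZl//; last 2 first.
    - exact/measurable_EFinP.
    - by move=> w _; rewrite lee_fin expR_ge0.
    by rewrite muleA -EFinM divff ?mul1e// gt_eqF.
  under eq_bigr => m _ do rewrite EM.
  rewrite -ge0_sume_distrr; last first.
    by move=> m _; apply: integral_ge0 => w _; rewrite mule_ge0 ?lee_fin ?expR_ge0.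
  rewrite -[leRHS]mule1 lee_pmul2l//.
  by apply: (change_of_measure j (F := fun _ _ => (M%:R^-1)%:E)) => // m y; rewrite lee_fin.
have intE (m : 'I_M) : P.-integrable setT (fun w => (E m w)%:E).
  apply/integrableP; split; first exact/measurable_EFinP.
  under eq_integral => w _ do rewrite gee0_abs ?lee_fin ?expR_ge0//.
  apply: (@le_lt_trans _ _ M%:R%:E); last exact: ltry.
  apply: le_trans E_leM; rewrite (bigD1 m)//= leeDl// sume_ge0// => m' _.
  by apply: integral_ge0 => w _; rewrite lee_fin expR_ge0.
have intDE (m : 'I_M) : P.-integrable setT (fun w => (D m w * E m w)%:E).
  apply: le_integrable (intE m) => //.
    by apply/measurable_EFinP; exact: measurable_funM.
  move=> w _; rewrite /= lee_fin normrM ler_piMl// /D indicE.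
  by case: (_ \in _); rewrite ?normr1 ?normr0.
have intD (m : 'I_M) : P.-integrable setT (fun w => (D m w)%:E).
  by apply: integrable_indic; exact: measurable_decoded.
have step (m : 'I_M) : 1 + (ln M%:R)%:E * P (decoded j m) <=
    (N0^-1)%:E * \sum_(t < n) power (signal h z c j m t) +
    (M%:R%:E * \int[P]_w (D m w * E m w)%:E + \int[P]_w (E m w)%:E).
  rewrite -(integral_llr (fin m)) -integralZl// -integralD//; last first.
    by apply: integrableZl.
  rewrite -integralD//; last 2 first.
  - exact: (integrable_llr (fin m)).
  - by apply: integrableD => //; exact: integrableZl.
  have -> : 1 + (ln M%:R)%:E * P (decoded j m) =
      \int[P]_w (1 + (ln M%:R)%:E * (D m w)%:E).
    rewrite integralD//; last 2 first.
    - exact: finite_measure_integrable_cst.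
    - exact: integrableZl.
    rewrite integral_cst//= probability_setT mule1 integralZl// integral_indic ?setIT//.
    exact: measurable_decoded.
  apply: le_integral => //.
  - apply: integrableD => //; last exact: integrableZl.
    exact: finite_measure_integrable_cst.
  - apply: integrableD => //; first exact: (integrable_llr (fin m)).
    by apply: integrableD => //; exact: integrableZl.
  - by move=> w _; rewrite -!EFinM -!EFinD lee_fin.
have : \sum_(m < M) (1 + (ln M%:R)%:E * P (decoded j m)) <=
    (N0^-1)%:E * \sum_(m < M) \sum_(t < n) power (signal h z c j m t) +
    (M%:R%:E * \sum_(m < M) \int[P]_w (D m w * E m w)%:E +
     \sum_(m < M) \int[P]_w (E m w)%:E).
  rewrite !ge0_sume_distrr; last 2 first.
  - by move=> m _; apply: integral_ge0 => w _; rewrite lee_fin mulr_ge0 ?expR_ge0.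
  - by move=> m _; apply: sume_ge0 => t _; exact: power_ge0.
  rewrite -!big_split/=; exact: lee_sum.
rewrite big_split/= -ge0_sume_distrr; last by move=> m _; exact: measure_ge0.
rewrite sumEFin sumr_const card_ord.
have -> : (1 *+ M)%:E = M%:R%:E :> \bar R by [].
set A := \sum_(m < M) P _; set S := (N0^-1)%:E * _ => le1.
have Mfin : (M%:R%:E : \bar R) \is a fin_num by [].
(* The constants 1 add up to M on the left, and the two exponential terms are at most M each on the
   right; one M cancels. *)
rewrite muleC -(leeD2lE _ _ Mfin) (le_trans le1)//.
rewrite [leRHS]addeA [leRHS]addeC leeD2l//.
apply: leeD => //.
by rewrite -[leRHS]mule1 lee_pmul2l.
Qed.

End run.
End converse.

(** * The energy bound *)

Section joint_law.
Local Open Scope ereal_scope.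
Context d (Omega : measurableType d) (R : realType) (P : probability Omega R).
Variable M : nat.
Hypothesis M_gt0 : (0 < M)%N.

Let MV_ge0 : (0 <= M%:R^-1 :> R)%R. Proof. by rewrite invr_ge0. Qed.

Lemma message_lawE (A : set nat) :
  message_law R M A = (M%:R^-1)%:E * \sum_(m < M) \d_(m : nat) A.
Proof.
rewrite /message_law /= /mnormalize /=.
have -> : msum (fun m : nat => \d_m) M [set: nat] = M%:R%:E :> \bar R.
  rewrite /msum /= (eq_bigr (fun=> 1%:E)) => [|m _]; last by rewrite diracT.
  by rewrite sumEFin sumr_const card_ord.
(* [mnormalize] falls back on [\d_0] for a null total mass, which [M_gt0] excludes. *)
rewrite eqe pnatr_eq0 -[_ == 0%N]negbK -lt0n M_gt0/= muleC.
by [].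
Qed.

Lemma message_law1 m : (m < M)%N -> message_law R M [set m] = (M%:R^-1)%:E.
Proof.
move=> mM; rewrite message_lawE (bigD1 (Ordinal mM))//= diracE mem_set//=.
rewrite big1 ?adde0 ?mule1// => i im; rewrite diracE memNset//= => E.
by move: im; rewrite -val_eqE/= E eqxx.
Qed.

(** The messages being countable and discrete, a preimage is a countable union of measurable
    slices. *)
Lemma measurable_fun_nat_prod d' (T : measurableType d') (f : nat * Omega -> T) :
  (forall m, measurable_fun setT (fun w => f (m, w))) -> measurable_fun setT f.
Proof.
move=> mf _ B mB; rewrite setTI.
have -> : f @^-1` B = \bigcup_m ([set m] `*` ((fun w => f (m, w)) @^-1` B)).
  apply/seteqP; split => [[m w] Bf|[m w] [m' _ [/= -> ?]]]; last by [].
  by exists m.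
apply: bigcupT_measurable => m; apply: measurableX => //.
by rewrite -[X in measurable X]setTI; exact: mf.
Qed.

Lemma integral_joint_law (f : nat * Omega -> \bar R) :
  (forall m, measurable_fun setT (fun w => f (m, w))) -> (forall x, 0 <= f x) ->
  \int[joint_law P M]_x f x =
  (M%:R^-1)%:E * \sum_(m < M) \int[P]_w f (m : nat, w).
Proof.
move=> mf f0.
rewrite (fubini_tonelli1 f (measurable_fun_nat_prod mf) f0) /fubini_F.
pose mu : {measure set nat -> \bar R} :=
  mscale (NngNum MV_ge0) (msum (fun m : nat => \d_m) M).
rewrite (eq_measure_integral mu); last by move=> A mA _; exact: message_lawE.
rewrite ge0_integral_mscale//; last by move=> m _; exact: integral_ge0.
rewrite ge0_integral_measure_sum//; last by move=> m _; exact: integral_ge0.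
congr (_ * _); apply: eq_bigr => m _.
by rewrite integral_dirac// diracT mul1e.
Qed.

Lemma cond_prob_message (A : set (nat * Omega)) m : (m < M)%N ->
  measurable [set w | A (m, w)] ->
  cond_prob (joint_law P M) A [set x | x.1 = m] = fine (P [set w | A (m, w)]).
Proof.
move=> mM mA; rewrite /cond_prob.
have -> : A `&` [set x | x.1 = m] = [set m] `*` [set w | A (m, w)].
  by apply/seteqP; split => [[m' w] [/= + e]|[m' w] [/= e +]]; rewrite e.
have -> : [set x : nat * Omega | x.1 = m] = [set m] `*` setT.
  by apply/seteqP; split => [[m' w] //= e|[m' w] []].
have JE A' B : measurable A' -> measurable B ->
    joint_law P M (A' `*` B) = message_law R M A' * P B.
  by move=> mA' mB; exact: product_measure1E.
rewrite !JE// probability_setT mule1 message_law1//.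
rewrite fineM ?fin_num_measure//= mulrC mulKf// invr_eq0 pnatr_eq0.
by rewrite -lt0n.
Qed.

End joint_law.

Lemma term_le_sum (R : realType) (I : finType) (f : I -> \bar R) i :
  (forall j, 0 <= f j)%E -> (f i <= \sum_j f j)%E.
Proof. by move=> f0; rewrite (bigD1 i)//= leeDl// sume_ge0. Qed.

Section energy_bound.
Local Open Scope ereal_scope.
Context d (Omega : measurableType d) (R : realType) (P : probability Omega R).
Variables (k : nat) (N0 : R).
Variables (h : 'I_k -> 'I_k -> nat -> Omega -> R[i])
          (z : 'I_k -> nat -> Omega -> R[i]).
Hypothesis network : fading_network P N0 h z.
Variables (n M : nat) (c : network_code R k n M).
Hypothesis M_gt0 : (0 < M)%N.

Let mh := fading_measurable network.
Let mz := noise_measurable network.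
Let M_gt0R : (0 < M%:R :> R)%R. Proof. by rewrite ltr0n. Qed.

Lemma total_energyE : total_energy P h z c =
  (M%:R^-1)%:E * \sum_(m < M) \sum_(i < k) \sum_(t < n)
    power P (fun w => sent h z c i t (m : nat, w)).
Proof.
have ms i t m : measurable_fun setT (fun w => (sqmod (sent h z c i t (m, w)))%:E).
  by apply/measurable_EFinP/measurable_sqmod/measurable_sent.
rewrite /total_energy expectation.unlock integral_joint_law//; last 2 first.
- move=> m; under eq_fun => w do rewrite -sumEFin.
  apply: emeasurable_sum => i; under eq_fun => w do rewrite -sumEFin.
  by apply: emeasurable_sum => t.
- by move=> x; rewrite lee_fin sumr_ge0// => i _; rewrite sumr_ge0// => t _; exact: sqmod_ge0.
congr (_ * _); apply: eq_bigr => m _.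
under eq_integral => w _ do rewrite -sumEFin.
under eq_integral => w _ do under eq_bigr => i _ do rewrite -sumEFin.
rewrite ge0_integral_sum//; last 2 first.
- by move=> i; apply: emeasurable_sum.
- by move=> i w _; apply: sume_ge0 => t _; rewrite lee_fin sqmod_ge0.
apply: eq_bigr => i _; rewrite ge0_integral_sum//.
by move=> t w _; rewrite lee_fin sqmod_ge0.
Qed.

(** A wrong decision at [j] alone is already an error, so [j] decodes at least as often as no error
    occurs. *)
Lemma decoded_error_probability (Dest : {set 'I_k}) j : j \in Dest ->
  (M%:R * (1 - error_probability P h z c Dest))%:E <=
  \sum_(m < M) P (decoded h z c j m).
Proof.
move=> jD.
pose err (m : nat) := [set w | error_event h z c Dest (m, w)].
have errE m : err m = \bigcup_(i in [set` Dest]) ~` decoded h z c i m.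
  apply/seteqP; split => [w [i iD Hi]|w [i iD Hi]]; exists i => //.
have merr m : measurable (err m).
  rewrite errE; apply: fin_bigcup_measurable => // i _; apply: measurableC.
  exact: (measurable_decoded network).
have PE m : P (decoded h z c j m) >= (1 - fine (P (err m)))%:E.
  rewrite EFinB fineK ?fin_num_measure// -[decoded h z c j m]setCK probability_setC; last first.
    by apply: measurableC; exact: (measurable_decoded network).
  rewrite leeB// le_measure ?inE//.
    by apply: measurableC; exact: (measurable_decoded network).
  by rewrite errE => w Hw; exists j.
rewrite /error_probability (eq_bigr (fun m : 'I_M => fine (P (err m)))); last first.
  by move=> m _; rewrite cond_prob_message//; exact: (merr m).
apply: (@le_trans _ _ (\sum_(m < M) (1 - fine (P (err m)))%:E)); last first.
  by apply: lee_sum => m _; exact: PE.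
rewrite sumEFin lee_fin sumrB sumr_const card_ord mulrBr mulr1.
by rewrite mulrC divfK// gt_eqF.
Qed.

Lemma gain_ge0 i j : 0 <= gain P h i j.
Proof. by rewrite -(fading_power network i j 0) power_ge0. Qed.

Lemma gain_fin_num i j : gain P h i j \is a fin_num.
Proof. by rewrite ge0_fin_numE ?gain_ge0// (fading_gain_finite network). Qed.

Lemma gain_diag i : gain P h i i = 0.
Proof.
rewrite -(fading_power network i i 0); apply: integral0_eq => w _.
by rewrite (fading_diag network) /sqmod /= expr0n addr0.
Qed.

Definition max_gain (Dest : {set 'I_k}) : \bar R :=
  \big[maxe/0]_(i < k) \sum_(j in Dest :\ i) gain P h i j.

Lemma max_gain_ge0 Dest : 0 <= max_gain Dest.
Proof.
apply: (big_ind (fun x => 0 <= x)) => // [x y x0 y0|i _]; first by rewrite le_max x0.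
by apply: sume_ge0 => j _; exact: gain_ge0.
Qed.

Lemma max_gain_lty Dest : max_gain Dest < +oo.
Proof.
apply: (big_ind (fun x => x < +oo)) => // [x y x0 y0|i _]; first by rewrite gt_max x0.
by apply: lte_sum_pinfty => j _; exact: (fading_gain_finite network).
Qed.

Lemma energy_converse (Dest : {set 'I_k}) (Etotal eps : R) :
  is_code P h z Dest Etotal eps c ->
  (#|Dest|%:R * ((1 - eps) * ln M%:R - 1))%:E <=
  (N0^-1)%:E * (max_gain Dest * Etotal%:E).
Proof.
move=> [_ En err].
pose e (m : 'I_M) i t := power P (fun w => sent h z c i t (m : nat, w)).
have e0 m i t : 0 <= e m i t by exact: power_ge0.
(* Finite total energy bounds every single input power; with finite gains the signals have finite
   power, as [fano] requires. *)
have sum_lty : \sum_(m < M) \sum_(i < k) \sum_(t < n) e m i t < +oo.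
  rewrite -[ltLHS]mul1e -(_ : (M%:R * M%:R^-1)%:E = 1); last by rewrite divff// gt_eqF.
  rewrite EFinM -muleA -total_energyE lte_mul_pinfty//.
  by rewrite (le_lt_trans En)// ltry.
have e_lty m i (t : 'I_n) : e m i t < +oo.
  have nn m' i' : 0 <= \sum_(t < n) e m' i' t by exact: sume_ge0.
  have nn' m' : 0 <= \sum_(i < k) \sum_(t < n) e m' i t by exact: sume_ge0.
  apply: le_lt_trans sum_lty.
  apply: le_trans (term_le_sum m nn').
  by apply: le_trans (term_le_sum i (nn m)); exact: term_le_sum.
have signalE j (m : 'I_M) t : power P (signal h z c j m t) =
    \sum_(i < k) gain P h i j * e m i t.
  exact: (signal_power network).
have signal_lty j (m : 'I_M) t : (t < n)%N -> power P (signal h z c j m t) < +oo.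
  move=> tn; rewrite signalE; apply: lte_sum_pinfty => i _.
  apply: lte_mul_pinfty; [exact: gain_ge0|exact: gain_fin_num|].
  exact: (e_lty m i (Ordinal tn)).
have each j : j \in Dest -> ((1 - eps) * ln M%:R - 1)%:E <=
    (N0^-1)%:E * ((M%:R^-1)%:E *
      \sum_(m < M) \sum_(t < n) power P (signal h z c j m t)).
  move=> jD; have := fano network M_gt0 (signal_lty j).
  set X := \sum_(m < M) \sum_(t < n) _.
  have X0 : 0 <= X by apply: sume_ge0 => m _; apply: sume_ge0 => t _; exact: power_ge0.
  have Xlty : X < +oo.
    by apply: lte_sum_pinfty => m _; apply: lte_sum_pinfty => t _; exact: signal_lty.
  have lnM0 : (0 <= ln M%:R :> R)%R by rewrite ln_ge0// ler1n.
  have Xfin : X \is a fin_num by rewrite ge0_fin_numE.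
  move=> /(le_trans (lee_wpmul2r _ (decoded_error_probability jD))).
  rewrite lee_fin => /(_ lnM0); rewrite -(fineK Xfin) -!EFinM -!EFinD !lee_fin.
  set x := fine X => le1.
  rewrite -(ler_pM2l M_gt0R) (@le_trans _ _ (M%:R *
    (1 - error_probability P h z c Dest) * ln M%:R - M%:R)%R)//.
    rewrite mulrBr mulr1 lerB// mulrA ler_wpM2r// ler_pM2l//.
    by rewrite lerB.
  have -> : (M%:R * (N0^-1 * (M%:R^-1 * x)) = N0^-1 * x)%R.
    by field; rewrite !gt_eqF// (noise_level_gt0 network).
  by rewrite lerBlDl.
have -> : (#|Dest|%:R * ((1 - eps) * ln M%:R - 1))%:E =
    \sum_(j in Dest) ((1 - eps) * ln M%:R - 1)%:E :> \bar R.
  by rewrite sumEFin sumr_const mulr_natl.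
apply: (le_trans (lee_sum _ each)).
have N0V_ge0 : (0 <= N0^-1)%R by rewrite invr_ge0 ltW// (noise_level_gt0 network).
have MV_ge0 : (0 <= M%:R^-1 :> R)%R by rewrite invr_ge0.
have sig0 j : 0 <= \sum_(m < M) \sum_(t < n) power P (signal h z c j m t).
  by apply: sume_ge0 => m _; apply: sume_ge0 => t _; exact: power_ge0.
rewrite -ge0_sume_distrr; last by move=> j _; rewrite mule_ge0.
rewrite lee_wpmul2l//.
rewrite -ge0_sume_distrr//.
apply: (@le_trans _ _ (max_gain Dest * total_energy P h z c)); last first.
  by rewrite lee_wpmul2l// max_gain_ge0.
rewrite total_energyE muleCA lee_wpmul2l//.
rewrite exchange_big/= ge0_sume_distrr; last first.
  by move=> m _; apply: sume_ge0 => i _; apply: sume_ge0 => t _; exact: power_ge0.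
apply: lee_sum => m _; rewrite exchange_big/= [in leRHS]exchange_big/=.
rewrite ge0_sume_distrr; last first.
  by move=> t _; apply: sume_ge0 => i _; exact: power_ge0.
apply: lee_sum => t _; under eq_bigr => j _ do rewrite signalE.
rewrite exchange_big/= ge0_sume_distrr; last by move=> i _; exact: power_ge0.
apply: lee_sum => i _; rewrite -ge0_sume_distrl; last by move=> j _; exact: gain_ge0.
rewrite lee_wpmul2r//.
apply: (@le_trans _ _ (\sum_(j in Dest :\ i) gain P h i j)); last first.
  exact: (le_bigmax _ (fun i => \sum_(j in Dest :\ i) gain P h i j) i).
(* A transmitter that is itself a destination contributes [gain i i], which is 0, so the sum may
   omit it. *)
rewrite [leLHS](bigID (fun j => j == i))/= [X in X + _]big1 ?add0e => [|j /andP[_ /eqP->]].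
  by rewrite (eq_bigl (mem (Dest :\ i)))// => j; rewrite !inE andbC.
exact: gain_diag.
Qed.

End energy_bound.

(** * The minimum energy per bit *)

(** Stated as a product to cover radius 0, where it says that no value is achievable. *)
Lemma achievable_lower_bound (R : realType) (k : nat)
  (d : measure_display) (Omega : measurableType d) (P : probability Omega R)
  (N0 : R) (h : 'I_k -> 'I_k -> nat -> Omega -> R[i])
  (z : 'I_k -> nat -> Omega -> R[i])
  (network : fading_network P N0 h z)
  (Dest : {set 'I_k}) (Dest_neq0 : Dest != finset.set0) (Eb : R) :
  achievable P h z Dest Eb ->
  N0 * ln 2 <= Eb * (fine (max_gain P h Dest) / #|Dest|%:R).
Proof.
move=> ach; set gam := _ / _.
have N0_gt0 := noise_level_gt0 network.
have D0 : 0 < #|Dest|%:R :> R by rewrite ltr0n card_gt0.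
have gfin : max_gain P h Dest \is a fin_num.
  by rewrite ge0_fin_numE ?(max_gain_ge0 network)// (max_gain_lty network).
have gam0 : 0 <= gam by rewrite divr_ge0// fine_ge0// (max_gain_ge0 network).
have ln2_gt0 : 0 < ln 2 :> R by rewrite ln_gt0// ltr1n.
(* The same [e] serves as error probability and as slack in the energy per bit; its second copy in
   [1 - 2 * e] absorbs the loss of 1. *)
have bound (e : R) : 0 < e < 1 -> N0 * ln 2 * (1 - 2 * e) <= (Eb + e) * gam.
  move=> /[dup] /ach[Eb0 +] /andP[e0 e1] => /(_ e e0)[E0 E00 HE].
  have Ebe0 : 0 < Eb + e by rewrite ltr_pwDr.
  (* The second argument is chosen so that the rate condition forces [1 <= e * ln M%:R]. *)
  pose Et := Num.max E0 ((Eb + e) / (ln 2 * e)).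
  have Et0 : 0 < Et by rewrite lt_max divr_gt0 ?mulr_gt0 ?orbT.
  have /HE[n [M [c [code M1 rate]]]] : E0 <= Et by rewrite le_max lexx.
  have lnM : 0 < ln M%:R :> R by rewrite ln_gt0// ltr1n.
  have := energy_converse network (ltnW M1) code.
  rewrite -(fineK gfin) -!EFinM lee_fin => conv.
  have {}rate : Et * ln 2 < (Eb + e) * ln M%:R.
    by move: rate; rewrite /log2 invf_div mulrA ltr_pdivrMr.
  have lnM_large : 1 <= e * ln M%:R.
    have : (Eb + e) / (ln 2 * e) <= Et by rewrite le_max lexx orbT.
    rewrite ler_pdivrMr ?mulr_gt0// => H.
    rewrite -(ler_pM2l Ebe0) mulr1 (le_trans H)//.
    have -> : Et * (ln 2 * e) = e * (Et * ln 2) by ring.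
    have -> : (Eb + e) * (e * ln M%:R) = e * ((Eb + e) * ln M%:R) by ring.
    by rewrite ler_pM2l// ltW.
  have conv' : N0 * ((1 - e) * ln M%:R - 1) <= Et * gam.
    have ND0 : 0 <= N0 / #|Dest|%:R by rewrite divr_ge0// ltW.
    have := ler_wpM2l ND0 conv.
    have -> : N0 / #|Dest|%:R * (#|Dest|%:R * ((1 - e) * ln M%:R - 1)) =
      N0 * ((1 - e) * ln M%:R - 1) by field; rewrite gt_eqF.
    have -> // : N0 / #|Dest|%:R * (N0^-1 * (fine (max_gain P h Dest) * Et)) =
      Et * gam by rewrite /gam; field; rewrite !gt_eqF.
  rewrite -(ler_pM2r lnM) (@le_trans _ _ (ln 2 * (N0 * ((1 - e) * ln M%:R - 1))))//.
    have -> : N0 * ln 2 * (1 - 2 * e) * ln M%:R =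
      ln 2 * (N0 * ((1 - e) * ln M%:R - e * ln M%:R)) by ring.
    by rewrite !ler_pM2l// lerB.
  rewrite (@le_trans _ _ (ln 2 * (Et * gam)))// ?ler_pM2l//.
  by rewrite mulrA [leRHS]mulrAC ler_wpM2r// mulrC ltW.
rewrite leNgt; apply/negP => lt.
(* In place of a limit, one small [e]: the bound gives gap <= e (K - gap), while e K is gap / 2.
   Including [gap] in [K] keeps [e] below 1. *)
pose gap := N0 * ln 2 - Eb * gam; have gap0 : 0 < gap by rewrite subr_gt0.
pose K := gam + 2 * (N0 * ln 2) + gap.
have K0 : 0 < K by rewrite /K ltr_wpDl// addr_ge0// !mulr_ge0// ltW.
pose e := gap / (2 * K); have eK : e * K = gap / 2.
  by rewrite /e; field; rewrite gt_eqF.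
have e0 : 0 < e by rewrite divr_gt0// mulr_gt0.
have e1 : e < 1.
  by rewrite /e ltr_pdivrMr ?mulr_gt0// /K; have := mulr_gt0 N0_gt0 ln2_gt0; lra.
have := bound e; rewrite e0 e1 => /(_ isT).
have := mulr_gt0 e0 gap0; move: eK gap0; rewrite /K /gap; lra.
Qed.

(* In [\bar R] the inverse of 0 is +oo, so the right-hand side is +oo when the
   network radius vanishes. *)
Theorem theorem1 (R : realType) (k : nat) (k_ge2 : (2 <= k)%N)
  (d : measure_display) (Omega : measurableType d) (P : probability Omega R)
  (N0 : R) (h : 'I_k -> 'I_k -> nat -> Omega -> R[i])
  (z : 'I_k -> nat -> Omega -> R[i])
  (network : fading_network P N0 h z)
  (Dest : {set 'I_k}) (Dest_neq0 : Dest != finset.set0)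
  (Dest_nosource : forall i : 'I_k, i \in Dest -> nat_of_ord i != 0%N) :
  ((ln 2)%:E / network_radius P h Dest <= Eb_min P h z Dest / N0%:E)%E.
Proof.
have N0_gt0 := noise_level_gt0 network.
have D0 : 0 < #|Dest|%:R :> R by rewrite ltr0n card_gt0.
have ln2_gt0 : 0 < ln 2 :> R by rewrite ln_gt0// ltr1n.
have gfin : max_gain P h Dest \is a fin_num.
  by rewrite ge0_fin_numE ?(max_gain_ge0 network)// (max_gain_lty network).
rewrite (_ : network_radius P h Dest =
  (fine (max_gain P h Dest) / #|Dest|%:R)%:E); last first.
  by rewrite EFinM fineK// /network_radius inver gt_eqF.
have gam0 : 0 <= fine (max_gain P h Dest) / #|Dest|%:R.
  by rewrite divr_ge0// fine_ge0// (max_gain_ge0 network).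
set gam := _ / _ in gam0 *.
rewrite (inver N0) gt_eqF// lee_pdivlMr//.
apply: le_ereal_inf_tmp => _ [Eb ach <-].
have := achievable_lower_bound network Dest_neq0 ach; rewrite -/gam => bound.
(* An achievable value forces a positive radius. If none exists, the infimum is [+oo] and there is
   nothing to show. *)
have gam_gt0 : 0 < gam.
  rewrite lt_neqAle gam0 andbT eq_sym; apply: contraTneq bound => ->.
  by rewrite mulr0 -ltNge mulr_gt0.
rewrite inver gt_eqF// -!EFinM lee_fin mulrAC ler_pdivrMr// mulrC.
exact: bound.
Qed.
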